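(* Let $f:\mathcal{C}\to\mathcal{D}$ be a functor between conventional categories and let $W$ be a multiplicative system in $\mathcal{C}$ satisfying the right calculus of fractions in the sense of Gabriel–Zisman. Then Deligne's definition of the left derived functor of $f$ coincides with the definition via localization of $\mathcal{E}_f$: the correspondence $\mathcal{E}^{\mathrm{Del}}\to[1]$ is a cocartesian fibration if and only if the localization $\mathcal{E}'_f\to[1]$ of $\mathcal{E}_f$ with respect to $W$ is a cocartesian fibration, and in this case the functor $\mathcal{C}'\to\mathcal{D}$ obtained from $\mathcal{E}^{\mathrm{Del}}$ is canonically isomorphic to the functor $\mathbf{L}f:\mathcal{C}'\to\mathcal{D}$ classifying $\mathcal{E}'_f$.
   Context: ''Conventional category'' means ordinary (1-)category; here localizations are taken in the conventional sense, and $\mathcal{C}\to\mathcal{C}'=\mathcal{C}[W^{-1}]$ is the localization of $\mathcal{C}$ ($\mathcal{D}$ is not localized). $\mathcal{E}_f\to[1]$ is the cocartesian fibration classified by $f$: its objects are $\mathrm{Ob}(\mathcal{C})\sqcup\mathrm{Ob}(\mathcal{D})$, with $\mathrm{Hom}_{\mathcal{E}_f}(x,y)$ equal to $\mathrm{Hom}_{\mathcal{C}}(x,y)$ for $x,y\in\mathcal{C}$, $\mathrm{Hom}_{\mathcal{D}}(x,y)$ for $x,y\in\mathcal{D}$, $\mathrm{Hom}_{\mathcal{D}}(f(x),y)$ for $x\in\mathcal{C},y\in\mathcal{D}$, and $\emptyset$ for $x\in\mathcal{D},y\in\mathcal{C}$. $\mathcal{E}'_f$ is the localization of $\mathcal{E}_f$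 with respect to $W$. If $\mathcal{E}'_f\to[1]$ is a cocartesian fibration, the left derived functor (in the localization sense) $\mathbf{L}f:\mathcal{C}'\to\mathcal{D}$ is the functor classifying it. Deligne's definition: for $x\in\mathcal{C}$ let $L_x$ be the category of arrows $s:x'\to x$ in $\mathcal{C}$ belonging to $W$ (morphisms are morphisms in $\mathcal{C}$ over $x$). Define $f':\mathcal{C}^{\mathrm{op}}\times\mathcal{D}\to\mathrm{Set}$ by $(x,y)\mapsto\mathrm{colim}\,(\phi_{x,y}:L_x^{\mathrm{op}}\to\mathrm{Set})$, where $\phi_{x,y}(s:x'\to x)=\mathrm{Hom}_{\mathcal{D}}(f(x'),y)$. The functor $f'$ defines a correspondence from $\mathcal{C}$ to $\mathcal{D}$, i.e. a category $\mathcal{E}^{\mathrm{Del}}\to[1]$ with fibers $\mathcal{C}$ over $0$ and $\mathcal{D}$ over $1$ and with $\mathrm{Hom}(x,y)=f'(x,y)$ for $x\in\mathcal{C}$, $y\in\mathcal{D}$. Deligne's left derived functor is defined whenever $\mathcal{E}^{\mathrm{Del}}\to[1]$ is a cocartesian fibration; in this case $\mathcal{E}^{\mathrm{Del}}$ classifies a functor $\mathcal{C}\to\mathcal{D}$ which carries $W$ to isomorphisms and hence factors uniquely through a functor $\mathcal{C}'\to\mathcal{D}$, which is Deligne's left derived functor. *)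

(* Defs.v *)
From Stdlib Require Import Relation_Operators.
From mathcomp Require Import all_boot boolp.

Set Implicit Arguments.
Unset Strict Implicit.
Unset Printing Implicit Defensive.

Declare Scope cat_scope.
Local Open Scope cat_scope.

(** * Categories, functors, natural isomorphisms *)

(* All categories live at one fixed pair of universe levels; the colimits
   below force objects to be small relative to Hom-sets. *)
Record Category := {
  Ob :> Type;
  Hom : Ob -> Ob -> Type;
  idm : forall x, Hom x x;
  compose : forall x y z, Hom y z -> Hom x y -> Hom x z;
  compose1m : forall x y (u : Hom x y), compose (idm y) u = u;
  composem1 : forall x y (u : Hom x y), compose u (idm x) = u;
  composeA : forall x y z t (w : Hom z t) (v : Hom y z) (u : Hom x y),
    compose w (compose v u) = compose (compose w v) u }.

Arguments Hom {_} _ _.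
Arguments idm {_} _.
Arguments compose {_ _ _ _} _ _.

Notation "v ∘ u" := (compose v u) (at level 40, left associativity) : cat_scope.

Record Functor (C D : Category) := {
  fob :> C -> D;
  fmap : forall x y : C, Hom x y -> Hom (fob x) (fob y);
  fmap1 : forall x : C, fmap (idm x) = idm (fob x);
  fmapM : forall (x y z : C) (v : Hom y z) (u : Hom x y),
    fmap (v ∘ u) = fmap v ∘ fmap u }.

Arguments fmap {_ _} _ {_ _} _.

Definition functor_id (C : Category) : Functor C C :=
  {| fob := fun x => x; fmap := fun x y u => u;
     fmap1 := fun x => erefl; fmapM := fun x y z v u => erefl |}.

Section FunctorComp.
Variables (A B C : Category) (G : Functor B C) (F : Functor A B).

Lemma functor_comp1 (x : A) : fmap G (fmap F (idm x)) = idm (G (F x)).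
Proof. by rewrite !fmap1. Qed.

Lemma functor_compM (x y z : A) (v : Hom y z) (u : Hom x y) :
  fmap G (fmap F (v ∘ u)) = fmap G (fmap F v) ∘ fmap G (fmap F u).
Proof. by rewrite !fmapM. Qed.

Definition functor_comp : Functor A C :=
  {| fob := fun x => G (F x); fmap := fun x y u => fmap G (fmap F u);
     fmap1 := functor_comp1; fmapM := functor_compM |}.
End FunctorComp.

Notation "G ∘F F" := (functor_comp G F) (at level 40, left associativity)
  : cat_scope.

Record NatTrans (C D : Category) (F G : Functor C D) := {
  ntc :> forall x : C, Hom (F x) (G x);
  ntN : forall (x y : C) (u : Hom x y), ntc y ∘ fmap F u = fmap G u ∘ ntc x }.

Record NatIso (C D : Category) (F G : Functor C D) := {
  ni_fwd :> NatTrans F G;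
  ni_inv : NatTrans G F;
  ni_fwdK : forall x, ni_inv x ∘ ni_fwd x = idm (F x);
  ni_invK : forall x, ni_fwd x ∘ ni_inv x = idm (G x) }.

Definition IsIso (C : Category) (x y : C) (u : Hom x y) : Prop :=
  exists v : Hom y x, v ∘ u = idm x /\ u ∘ v = idm y.

Definition IsEquivalence (C D : Category) (F : Functor C D) : Prop :=
  exists G : Functor D C, inhabited (NatIso (G ∘F F) (functor_id C)) /\
                          inhabited (NatIso (F ∘F G) (functor_id D)).

(** * Localization *)

Definition MorClass (C : Category) := forall x y : C, Hom x y -> Prop.

Definition Inverts (C X : Category) (W : MorClass C) (F : Functor C X) : Prop :=
  forall (x y : C) (s : Hom x y), W x y s -> IsIso (fmap F s).

(* [Q : C -> C'] exhibits [C'] as [C[W^-1]]: for every [X], precomposition with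
   [Q] is an equivalence from the functors [C' -> X] to the functors [C -> X]
   inverting [W]; the last two clauses are essential surjectivity and full
   faithfulness of this precomposition functor. *)
Definition IsLocalization (C C' : Category) (W : MorClass C) (Q : Functor C C')
    : Prop :=
  [/\ Inverts W Q,
      forall (X : Category) (F : Functor C X), Inverts W F ->
        exists F' : Functor C' X, inhabited (NatIso (F' ∘F Q) F)
    & forall (X : Category) (F G : Functor C' X)
             (t : NatTrans (F ∘F Q) (G ∘F Q)),
        exists t' : NatTrans F G, (forall x : C, t' (Q x) = t x) /\
          forall t'' : NatTrans F G, (forall x : C, t'' (Q x) = t x) ->
            forall z : C', t'' z = t' z].

(* Gabriel-Zisman calculus of right fractions: fractions are [u s^-1], i.e.
   roofs [x <-s- x' -u-> y] with [s] in [W]. *)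
Record RightFractions (C : Category) (W : MorClass C) : Prop := {
  rf_id : forall x : C, W x x (idm x);
  rf_comp : forall (x y z : C) (t : Hom y z) (s : Hom x y),
    W y z t -> W x y s -> W x z (t ∘ s);
  rf_ore : forall (x y z : C) (s : Hom y x) (u : Hom z x), W y x s ->
    exists (z' : C) (s' : Hom z' z) (u' : Hom z' y),
      W z' z s' /\ s ∘ u' = u ∘ s';
  rf_cancel : forall (x y z : C) (u v : Hom x y) (t : Hom y z), W y z t ->
    t ∘ u = t ∘ v ->
    exists (x' : C) (s : Hom x' x), W x' x s /\ u ∘ s = v ∘ s }.

(** * Cocartesian fibrations *)

Definition IsCocartesian (E B : Category) (p : Functor E B) (x y : E)
    (u : Hom x y) : Prop :=
  forall (z : E) (w : Hom x z) (b : Hom (p y) (p z)), b ∘ fmap p u = fmap p w ->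
    exists! v : Hom y z, fmap p v = b /\ v ∘ u = w.

Definition IsCocartesianFibration (E B : Category) (p : Functor E B) : Prop :=
  forall (x : E) (b : B) (w : Hom (p x) b),
    exists (y : E) (e : p y = b) (u : Hom x y),
      IsCocartesian p u /\ eq_rect (p y) (Hom (p x)) (fmap p u) b e = w.

(** * The poset [[1]], opposite and product categories *)

(* [false] is the object 0 and [true] is the object 1. *)
Definition arrow_hom (a b : bool) : Type := is_true (a ==> b).
Lemma arrow_id (a : bool) : arrow_hom a a.
Proof. exact: implybb. Qed.
Lemma arrow_comp (a b c : bool) :
  arrow_hom b c -> arrow_hom a b -> arrow_hom a c.
Proof. by rewrite /arrow_hom; case: a; case: b. Qed.
Lemma arrow_irr (a b : bool) (u v : arrow_hom a b) : u = v.
Proof. exact: bool_irrelevance. Qed.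

Definition Arrow : Category :=
  {| Ob := bool; Hom := arrow_hom; idm := arrow_id; compose := arrow_comp;
     compose1m := fun a b u => arrow_irr _ _;
     composem1 := fun a b u => arrow_irr _ _;
     composeA := fun a b c d w v u => arrow_irr _ _ |}.

Definition opc (C : Category) : Category :=
  {| Ob := C; Hom := fun x y => @Hom C y x; idm := fun x => @idm C x;
     compose := fun x y z v u => @compose C z y x u v;
     compose1m := fun x y u => composem1 u;
     composem1 := fun x y u => compose1m u;
     composeA := fun x y z t w v u => esym (composeA u v w) |}.

Section Product.
Variables C D : Category.
Definition prod_hom (x y : C * D) : Type := (Hom x.1 y.1 * Hom x.2 y.2)%type.
Definition prod_id (x : C * D) : prod_hom x x := (idm x.1, idm x.2).
Definition prod_comp (x y z : C * D) (v : prod_hom y z) (u : prod_hom x y)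
  : prod_hom x z := (v.1 ∘ u.1, v.2 ∘ u.2).
Lemma prod_1m (x y : C * D) (u : prod_hom x y) : prod_comp (prod_id y) u = u.
Proof. by case: u => u1 u2; rewrite /prod_comp /= !compose1m. Qed.
Lemma prod_m1 (x y : C * D) (u : prod_hom x y) : prod_comp u (prod_id x) = u.
Proof. by case: u => u1 u2; rewrite /prod_comp /= !composem1. Qed.
Lemma prod_A (x y z t : C * D) (w : prod_hom z t) (v : prod_hom y z)
  (u : prod_hom x y) : prod_comp w (prod_comp v u) = prod_comp (prod_comp w v) u.
Proof. by rewrite /prod_comp /= !composeA. Qed.

Definition prodc : Category :=
  {| Ob := (C * D)%type; Hom := prod_hom; idm := prod_id; compose := prod_comp;
     compose1m := prod_1m; composem1 := prod_m1; composeA := prod_A |}.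
End Product.

(** * Set-valued functors and their colimits *)

Record SetFunctor (J : Category) := {
  sob :> J -> Type;
  smap : forall i j : J, Hom i j -> sob i -> sob j;
  smap1 : forall (i : J) (a : sob i), smap (idm i) a = a;
  smapM : forall (i j k : J) (v : Hom j k) (u : Hom i j) (a : sob i),
    smap (v ∘ u) a = smap v (smap u a) }.

Arguments smap {_} _ {_ _} _ _.

Section Colimit.
Variables (J : Category) (F : SetFunctor J).

Inductive colim_step : {j : J & F j} -> {j : J & F j} -> Prop :=
  ColimStep (i j : J) (u : Hom i j) (a : F i) :
    colim_step (existT _ i a) (existT _ j (smap F u a)).

Definition colim_rel := clos_refl_sym_trans _ colim_step.

(* The quotient of the disjoint union by [colim_rel], as a set of classes. *)
Definition colim : Type :=
  {A : {j : J & F j} -> Prop | exists a, A = colim_rel a}.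

Definition colim_class (a : {j : J & F j}) : colim :=
  exist _ (colim_rel a) (ex_intro _ a erefl).

Definition colim_in (j : J) (a : F j) : colim := colim_class (existT _ j a).

Lemma colim_classE a b : colim_rel a b -> colim_class a = colim_class b.
Proof.
move=> ab; apply: eq_exist => /=.
apply: funext => c; apply: propext; split => h.
  by apply: rst_trans h; apply: rst_sym.
by apply: rst_trans h.
Qed.

Lemma colim_class_inj a b : colim_class a = colim_class b -> colim_rel a b.
Proof. by case=> ->; apply: rst_refl. Qed.

Lemma colim_inE (i j : J) (u : Hom i j) (a : F i) :
  colim_in (smap F u a) = colim_in a.
Proof. by apply: colim_classE; apply: rst_sym; apply: rst_step. Qed.

Lemma colim_classP (q : colim) : exists a, q = colim_class a.
Proof. by case: q => A [a eA]; exists a; apply: eq_exist. Qed.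

Lemma colim_inP (q : colim) : exists (j : J) (a : F j), q = colim_in a.
Proof. by have [[j a] ->] := colim_classP q; exists j, a. Qed.

Definition colim_repr (q : colim) : {j : J & F j} := projT1 (cid (colim_classP q)).

Lemma colim_reprK (q : colim) : colim_class (colim_repr q) = q.
Proof. by rewrite /colim_repr; case: cid. Qed.

Definition colim_rec (T : Type) (c : forall j, F j -> T) (q : colim) : T :=
  c _ (projT2 (colim_repr q)).

Lemma colim_recE (T : Type) (c : forall j, F j -> T) :
  (forall (i j : J) (u : Hom i j) (a : F i), c j (smap F u a) = c i a) ->
  forall (j : J) (a : F j), colim_rec c (colim_in a) = c j a.
Proof.
move=> cE j a; rewrite /colim_rec.
have: colim_rel (colim_repr (colim_in a)) (existT _ j a).
  by apply: colim_class_inj; rewrite colim_reprK.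
have cR x y : colim_rel x y -> c _ (projT2 x) = c _ (projT2 y).
  by elim=> {x y} [x y []|x|x y _ ->|x y z _ -> _ ->] //= *; rewrite cE.
by move/cR.
Qed.
End Colimit.

(** * Correspondences *)

(* A correspondence from [C] to [D], given as a functor [P : C^op x D -> Set],
   and the associated category over [[1]]. *)
Section Correspondence.
Variables (C D : Category) (P : SetFunctor (prodc (opc C) D)).

Definition corr_hom (a b : C + D) : Type :=
  match a, b with
  | inl x, inl y => Hom x y
  | inl x, inr y => P (x, y)
  | inr _, inl _ => Empty_set
  | inr x, inr y => Hom x y
  end.

Definition corr_id (a : C + D) : corr_hom a a :=
  match a with inl x => idm x | inr y => idm y end.

Definition corr_lact (x x' : C) (y : D) (g : Hom x' x) (q : P (x, y))
    : P (x', y) :=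
  @smap _ P (x, y) (x', y) (g, idm y) q.

Definition corr_ract (x : C) (y y' : D) (k : Hom y y') (q : P (x, y))
    : P (x, y') :=
  @smap _ P (x, y) (x, y') (idm (x : C), k) q.

Definition corr_comp (a b c : C + D) :
    corr_hom b c -> corr_hom a b -> corr_hom a c :=
  match a, b, c return corr_hom b c -> corr_hom a b -> corr_hom a c with
  | inl x, inl y, inl z => fun v u => v ∘ u
  | inl x, inl y, inr z => fun q u => corr_lact u q
  | inl x, inr y, inr z => fun v q => corr_ract v q
  | inr x, inr y, inr z => fun v u => v ∘ u
  | inr _, inl _, _ => fun _ u => match u with end
  | _, inr _, inl _ => fun v _ => match v with end
  end.

Lemma corr_1m a b (u : corr_hom a b) : corr_comp (corr_id b) u = u.
Proof.
case: a b u => [x|x] [y|y] //= u; try exact: compose1m.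
exact: (smap1 (s := P) (i := (x, y)) u).
Qed.

Lemma corr_m1 a b (u : corr_hom a b) : corr_comp u (corr_id a) = u.
Proof.
case: a b u => [x|x] [y|y] //= u; try exact: composem1.
exact: (smap1 (s := P) (i := (x, y)) u).
Qed.

Lemma corr_A a b c d (w : corr_hom c d) (v : corr_hom b c) (u : corr_hom a b) :
  corr_comp w (corr_comp v u) = corr_comp (corr_comp w v) u.
Proof.
case: a b c d w v u => [x|x] [y|y] [z|z] [t|t] //= w v u;
  try exact: composeA; rewrite /corr_lact /corr_ract -!smapM;
  congr (smap P _ _); rewrite /= /prod_comp /= ?compose1m ?composem1 //.
Qed.

Definition corr : Category :=
  {| Ob := (C + D)%type; Hom := corr_hom; idm := corr_id; compose := corr_comp;
     compose1m := corr_1m; composem1 := corr_m1; composeA := corr_A |}.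

Definition corr_hom01 (x : C) (y : D) (q : P (x, y)) : @Hom corr (inl x) (inr y)
  := q.

Definition corr_in0 : Functor C corr :=
  {| fob := (inl : C -> corr); fmap := fun x y (u : Hom x y) => u;
     fmap1 := fun x => erefl; fmapM := fun x y z v u => erefl |}.

Definition corr_in1 : Functor D corr :=
  {| fob := (inr : D -> corr); fmap := fun x y (u : Hom x y) => u;
     fmap1 := fun x => erefl; fmapM := fun x y z v u => erefl |}.

Definition corr_side (a : corr) : Arrow := if a is inl _ then false else true.

Lemma corr_side_hom (a b : corr) :
  Hom a b -> Hom (corr_side a) (corr_side b).
Proof. by case: a b => [x|x] [y|y]. Qed.

Definition corr_proj : Functor corr Arrow :=
  {| fob := corr_side; fmap := corr_side_hom;
     fmap1 := fun x => arrow_irr _ _; fmapM := fun x y z v u => arrow_irr _ _ |}.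
End Correspondence.

(** * The cocartesian fibration [E_f -> [1]] classified by a functor *)

Section Cylinder.
Variables (C D : Category) (f : Functor C D).

Definition cyl_map (a b : prodc (opc C) D) (u : Hom a b) (h : Hom (f a.1) a.2)
  : Hom (f b.1) b.2 := u.2 ∘ h ∘ fmap f u.1.

Lemma cyl_map1 (a : prodc (opc C) D) (h : Hom (f a.1) a.2) :
  cyl_map (idm a) h = h.
Proof. by rewrite /cyl_map /= compose1m fmap1 composem1. Qed.

Lemma cyl_mapM (a b c : prodc (opc C) D) (v : Hom b c) (u : Hom a b)
  (h : Hom (f a.1) a.2) : cyl_map (v ∘ u) h = cyl_map v (cyl_map u h).
Proof. by rewrite /cyl_map /= fmapM !composeA. Qed.

(* [(x, y) |-> Hom_D (f x, y)] *)
Definition cyl_functor : SetFunctor (prodc (opc C) D) :=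
  {| sob := fun a : prodc (opc C) D => Hom (f a.1) a.2; smap := cyl_map;
     smap1 := cyl_map1; smapM := cyl_mapM |}.

Definition cyl : Category := corr cyl_functor.
Definition cyl_in0 : Functor C cyl := corr_in0 cyl_functor.
Definition cyl_in1 : Functor D cyl := corr_in1 cyl_functor.
Definition cyl_proj : Functor cyl Arrow := corr_proj cyl_functor.

Definition cyl_arrow (x : C) (y : D) (h : Hom (f x) y)
  : Hom (cyl_in0 x) (cyl_in1 y) := @corr_hom01 C D cyl_functor x y h.

(* [W], seen in the fiber of [E_f] over 0. *)
Definition cyl_class (W : MorClass C) : MorClass cyl :=
  fun a b => match a, b return @Hom cyl a b -> Prop with
             | inl x, inl y => fun u => W x y u
             | _, _ => fun _ => False
             end.
End Cylinder.

(* [F : A -> B] classifies [p : E -> [1]], the fibers over 0 and 1 being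
   identified with [A] and [B] by means of [i0] and [i1]: there is an equivalence
   [E_F -> E] over [[1]] compatible with these identifications. *)
Record Classification (A B E : Category) (p : Functor E Arrow)
    (i0 : Functor A E) (i1 : Functor B E) (F : Functor A B) := {
  cl_fun : Functor (cyl F) E;
  cl_equiv : IsEquivalence cl_fun;
  cl_over : NatIso (p ∘F cl_fun) (cyl_proj F);
  cl_iso0 : NatIso (cl_fun ∘F cyl_in0 F) i0;
  cl_iso1 : NatIso (cl_fun ∘F cyl_in1 F) i1 }.

(* The image in [E] of the cocartesian arrow [x -> F x] of [E_F]. *)
Definition cl_arrow (A B E : Category) (p : Functor E Arrow)
    (i0 : Functor A E) (i1 : Functor B E) (F : Functor A B)
    (c : Classification p i0 i1 F) (x : A) : Hom (i0 x) (i1 (F x)) :=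
  cl_iso1 c (F x) ∘ fmap (cl_fun c) (cyl_arrow (idm (F x)))
    ∘ ni_inv (cl_iso0 c) x.

(** * Deligne's correspondence *)

Section Deligne.
Variables (C D : Category) (f : Functor C D).
Variables (W : MorClass C) (HW : RightFractions W).

Record over_ob (x : C) := OverOb {
  ov_src : C;
  ov_arr : Hom ov_src x;
  ov_W : W ov_arr }.

Section OverCategory.
Variable x : C.
Definition over_hom (s t : over_ob x) : Type :=
  {a : Hom (ov_src s) (ov_src t) | ov_arr t ∘ a = ov_arr s}.
Definition over_id (s : over_ob x) : over_hom s s :=
  exist _ (idm (ov_src s)) (composem1 (ov_arr s)).
Lemma over_comp_subproof (s t r : over_ob x) (b : over_hom t r)
  (a : over_hom s t) : ov_arr r ∘ (sval b ∘ sval a) = ov_arr s.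
Proof. by rewrite composeA (svalP b) (svalP a). Qed.
Definition over_comp (s t r : over_ob x) (b : over_hom t r) (a : over_hom s t)
  : over_hom s r := exist _ (sval b ∘ sval a) (over_comp_subproof b a).
Lemma over_1m (s t : over_ob x) (a : over_hom s t) : over_comp (over_id t) a = a.
Proof. by case: a => a ea; apply: eq_exist; apply: compose1m. Qed.
Lemma over_m1 (s t : over_ob x) (a : over_hom s t) : over_comp a (over_id s) = a.
Proof. by case: a => a ea; apply: eq_exist; apply: composem1. Qed.
Lemma over_A (s t r q : over_ob x) (c : over_hom r q) (b : over_hom t r)
  (a : over_hom s t) : over_comp c (over_comp b a) = over_comp (over_comp c b) a.
Proof. by apply: eq_exist; apply: composeA. Qed.

(* The category [L_x] of arrows [x' -> x] in [W]. *)
Definition Lcat : Category :=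
  {| Ob := over_ob x; Hom := over_hom; idm := over_id; compose := over_comp;
     compose1m := over_1m; composem1 := over_m1; composeA := over_A |}.
End OverCategory.

Section Phi.
Variables (x : C) (y : D).
Definition phi_map (s t : opc (Lcat x)) (a : Hom s t) (h : Hom (f (ov_src s)) y)
  : Hom (f (ov_src t)) y := h ∘ fmap f (sval a).
Lemma phi_map1 (s : opc (Lcat x)) (h : Hom (f (ov_src s)) y) :
  phi_map (idm s) h = h.
Proof. by rewrite /phi_map /= fmap1 composem1. Qed.
Lemma phi_mapM (s t r : opc (Lcat x)) (b : Hom t r) (a : Hom s t)
  (h : Hom (f (ov_src s)) y) : phi_map (b ∘ a) h = phi_map b (phi_map a h).
Proof. by rewrite /phi_map /= fmapM composeA. Qed.

Definition phi : SetFunctor (opc (Lcat x)) :=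
  {| sob := fun s : opc (Lcat x) => Hom (f (ov_src s)) y; smap := phi_map;
     smap1 := phi_map1; smapM := phi_mapM |}.

(* The class of [h : f x' -> y] at [s : x' -> x]. *)
Definition del_in (s : over_ob x) (h : Hom (f (ov_src s)) y) : colim phi :=
  @colim_in _ phi s h.

Lemma del_inE (s t : over_ob x) (a : Hom (ov_src t) (ov_src s))
  (ea : ov_arr s ∘ a = ov_arr t) (h : Hom (f (ov_src s)) y) :
  del_in (s := t) (h ∘ fmap f a) = del_in h.
Proof.
exact: (@colim_inE _ phi s t (exist _ a ea : @Hom (opc (Lcat x)) s t) h).
Qed.

Lemma del_inP (q : colim phi) :
  exists (s : over_ob x) (h : Hom (f (ov_src s)) y), q = del_in h.
Proof. exact: (colim_inP q). Qed.
End Phi.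

Lemma ore_ex (x z : C) (g : Hom z x) (s : over_ob x) :
  exists t : {t : over_ob z & Hom (ov_src t) (ov_src s)},
    ov_arr s ∘ projT2 t = g ∘ ov_arr (projT1 t).
Proof.
have [z' [s' [u' [Ws' e]]]] := rf_ore HW g (ov_W s).
by exists (existT _ (OverOb Ws') u').
Qed.

(* A chosen Ore square completing [g] and [s]; the action below does not depend
   on the choice, see [del_map_inE]. *)
Definition ore (x z : C) (g : Hom z x) (s : over_ob x)
  : {t : over_ob z & Hom (ov_src t) (ov_src s)} := projT1 (cid (ore_ex g s)).

Lemma oreE (x z : C) (g : Hom z x) (s : over_ob x) :
  ov_arr s ∘ projT2 (ore g s) = g ∘ ov_arr (projT1 (ore g s)).
Proof. by rewrite /ore; case: cid. Qed.

Lemma ore_unique (x z : C) (y : D) (g : Hom z x) (s : over_ob x)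
  (t1 t2 : over_ob z) (g1 : Hom (ov_src t1) (ov_src s))
  (g2 : Hom (ov_src t2) (ov_src s)) (h : Hom (f (ov_src s)) y) :
  ov_arr s ∘ g1 = g ∘ ov_arr t1 -> ov_arr s ∘ g2 = g ∘ ov_arr t2 ->
  del_in (s := t1) (h ∘ fmap f g1) = del_in (s := t2) (h ∘ fmap f g2).
Proof.
move=> e1 e2.
have [w [b1 [b2 [Wb1 eb]]]] := rf_ore HW (ov_arr t1) (ov_W t2).
have e3 : ov_arr s ∘ (g1 ∘ b1) = ov_arr s ∘ (g2 ∘ b2).
  by rewrite !composeA e1 e2 -!composeA eb.
have [v [c [Wc ec]]] := rf_cancel HW (ov_W s) e3.
have Wt : W (ov_arr t1 ∘ (b1 ∘ c)).
  by apply: (rf_comp HW) (ov_W t1) _; apply: (rf_comp HW).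
pose t3 := OverOb Wt.
have a1 : ov_arr t1 ∘ (b1 ∘ c) = ov_arr t3 by [].
have a2 : ov_arr t2 ∘ (b2 ∘ c) = ov_arr t3 by rewrite composeA eb -composeA.
rewrite -(del_inE (t := t3) a1) -(del_inE (t := t3) a2) -!composeA -!fmapM !composeA.
by rewrite ec.
Qed.

Section Action.
Variables (x z : C) (y y' : D) (g : Hom z x) (k : Hom y y').

Definition del_act_at (s : over_ob x) (h : Hom (f (ov_src s)) y)
  : colim (phi z y') :=
  del_in (s := projT1 (ore g s)) (k ∘ h ∘ fmap f (projT2 (ore g s))).

(* [f'] on morphisms: [s, h] is sent to [t, k h f(g')] for any Ore square
   [s g' = g t] with [t] in [W]. *)
Definition del_act : colim (phi x y) -> colim (phi z y') :=
  colim_rec (F := phi x y) del_act_at.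

Lemma del_act_inE (s : over_ob x) (h : Hom (f (ov_src s)) y) (t : over_ob z)
  (g' : Hom (ov_src t) (ov_src s)) : ov_arr s ∘ g' = g ∘ ov_arr t ->
  del_act (del_in h) = del_in (s := t) (k ∘ h ∘ fmap f g').
Proof.
move=> e; rewrite /del_act /del_in colim_recE.
  by apply: ore_unique e; apply: oreE.
move=> i j [a /= ea] h'; rewrite /del_act_at /phi_map /= -!composeA -fmapM !composeA.
apply: ore_unique; last exact: oreE.
by rewrite composeA ea oreE.
Qed.
End Action.

Definition del_map (a b : prodc (opc C) D) (u : Hom a b)
  : colim (phi a.1 a.2) -> colim (phi b.1 b.2) := del_act u.1 u.2.

Lemma del_map1 (a : prodc (opc C) D) (q : colim (phi a.1 a.2)) :
  del_map (idm a) q = q.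
Proof.
have [s [h ->]] := del_inP q; rewrite /del_map.
rewrite (@del_act_inE _ _ _ _ _ _ s h s (idm _)) /=; last first.
  by rewrite composem1 compose1m.
by rewrite fmap1 composem1 compose1m.
Qed.

Lemma del_mapM (a b c : prodc (opc C) D) (v : Hom b c) (u : Hom a b)
  (q : colim (phi a.1 a.2)) : del_map (v ∘ u) q = del_map v (del_map u q).
Proof.
have [s [h ->]] := del_inP q; rewrite /del_map.
have e1 := oreE u.1 s; set t := projT1 _ in e1; set g1 := projT2 _ in e1.
have e2 := oreE v.1 t; set r := projT1 _ in e2; set g2 := projT2 _ in e2.
rewrite (del_act_inE _ _ e1) (del_act_inE _ _ e2).
rewrite (@del_act_inE _ _ _ _ _ _ s h r (g1 ∘ g2)).
  by rewrite fmapM /= !composeA.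
by rewrite composeA e1 -composeA e2 /= composeA.
Qed.

(* [f' : C^op x D -> Set] *)
Definition del_functor : SetFunctor (prodc (opc C) D) :=
  {| sob := fun a : prodc (opc C) D => colim (phi a.1 a.2); smap := del_map;
     smap1 := del_map1; smapM := del_mapM |}.

Definition del : Category := corr del_functor.
Definition del_in0 : Functor C del := corr_in0 del_functor.
Definition del_in1 : Functor D del := corr_in1 del_functor.
Definition del_proj : Functor del Arrow := corr_proj del_functor.

Definition del_arrow (x x' : C) (y : D) (s : Hom x' x) (Ws : W s)
  (h : Hom (f x') y) : Hom (del_in0 x) (del_in1 y) :=
  @corr_hom01 C D del_functor x y (@del_in x y (OverOb Ws) h).
End Deligne.

(** * The two left derived functors *)

(* Deligne's left derived functor: the functor [C' -> D] through which the functor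
   [C -> D] classifying Deligne's correspondence factors. *)
Record DeligneDerived (C D C' : Category) (f : Functor C D) (W : MorClass C)
    (HW : RightFractions W) (Q : Functor C C') := {
  dd_fun :> Functor C' D;
  dd_base : Functor C D;
  dd_class : Classification (del_proj f HW) (del_in0 f HW) (del_in1 f HW) dd_base;
  dd_factor : NatIso (dd_fun ∘F Q) dd_base }.

(* The left derived functor in the localization sense: the functor [C' -> D]
   classifying the localization [p' : E' -> [1]] of [E_f], whose fibers are
   identified with [C'] and [D] by means of [j] and of [D -> E_f -> E']. *)
Record LocDerived (C D C' E' : Category) (f : Functor C D)
    (G : Functor (cyl f) E') (p' : Functor E' Arrow) (j : Functor C' E') := {
  ld_fun :> Functor C' D;
  ld_class : Classification p' j (G ∘F cyl_in1 f) ld_fun }.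

(* The canonical functor from Deligne's correspondence to [E'] sends the class of
   [h : f x' -> y] at [s : x' -> x] to [G h (G s)^-1].  An isomorphism [th] between
   the two derived functors is canonical when, for every [x], it makes this functor
   match the universal arrow [x -> F x] in Deligne's correspondence with the
   universal arrow [Q x -> L (Q x)] in [E'].  The inverse of [G s] is moved to the
   other side of the equation. *)
Definition IsCanonical (C D C' E' : Category) (f : Functor C D) (W : MorClass C)
    (HW : RightFractions W) (Q : Functor C C') (G : Functor (cyl f) E')
    (p' : Functor E' Arrow) (j : Functor C' E')
    (hj : NatIso (j ∘F Q) (G ∘F cyl_in0 f))
    (L1 : DeligneDerived f HW Q) (L2 : LocDerived G p' j)
    (th : NatIso L1 L2) : Prop :=
  forall (x x' : C) (s : Hom x' x) (Ws : W x' x s)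
         (h : Hom (f x') (dd_base L1 x)),
    cl_arrow (dd_class L1) x = del_arrow HW Ws h ->
    fmap (G ∘F cyl_in1 f) (th (Q x) ∘ ni_inv (dd_factor L1) x)
      ∘ fmap G (cyl_arrow h)
    = cl_arrow (ld_class L2) (Q x) ∘ ni_inv hj x ∘ fmap (G ∘F cyl_in0 f) s.

(* Main.v *)
(* Hom-sets of a localization with right fractions are colimits of
   roofs: the same formula [colim_{L_x} Hom (f x', y)] which defines Deligne's
   correspondence, taken for [f = id].  Adding the isomorphisms of [D] to [W] makes
   [E_f] a category with right fractions, so [Hom (G x, G y)] in [E'] is Deligne's
   [f' (x, y)] for [x] in [C] and [y] in [D], while [C'] and [D] embed fully
   faithfully in [E'].  Over [[1]], cocartesian fibrations are those in which every
   object over 0 has a universal arrow to the fiber over 1, and the classifying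
   functor is read off these arrows; hence both correspondences are cocartesian
   together, and the two classifying functors agree, first on the image of [Q] and
   then on [C'] by the universal property of the localization. *)
From mathcomp Require Import all_boot boolp.
Require Import Defs.

Set Implicit Arguments.
Unset Strict Implicit.
Unset Printing Implicit Defensive.
Local Open Scope cat_scope.

(** * Isomorphisms with chosen inverses, and natural isomorphisms *)

Section Isomorphisms.
Variable C : Category.

Lemma iso_id (x : C) : IsIso (idm x).
Proof. by exists (idm x); rewrite compose1m. Qed.

Lemma iso_comp (x y z : C) (v : Hom y z) (u : Hom x y) :
  IsIso v -> IsIso u -> IsIso (v ∘ u).
Proof.
move=> [v' [v'v vv']] [u' [u'u uu']]; exists (u' ∘ v'); split.
  by rewrite composeA -(composeA u') v'v composem1.
by rewrite composeA -(composeA v) uu' composem1.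
Qed.

Lemma iso_epi (x y z : C) (s : Hom x y) (u v : Hom y z) :
  IsIso s -> u ∘ s = v ∘ s -> u = v.
Proof.
move=> [s' [_ ss']] e.
by rewrite -(composem1 u) -(composem1 v) -ss' !composeA e.
Qed.

Lemma iso_mono (x y z : C) (s : Hom y z) (u v : Hom x y) :
  IsIso s -> s ∘ u = s ∘ v -> u = v.
Proof.
move=> [s' [s's _]] e.
by rewrite -(compose1m u) -(compose1m v) -s's -!composeA e.
Qed.

Definition iso_inv (x y : C) (u : Hom x y) (hu : IsIso u) : Hom y x :=
  projT1 (cid hu).

Lemma iso_invK (x y : C) (u : Hom x y) (hu : IsIso u) : iso_inv hu ∘ u = idm x.
Proof. by rewrite /iso_inv; case: cid => v []. Qed.

Lemma iso_Kinv (x y : C) (u : Hom x y) (hu : IsIso u) : u ∘ iso_inv hu = idm y.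
Proof. by rewrite /iso_inv; case: cid => v []. Qed.

Lemma iso_inv_iso (x y : C) (u : Hom x y) (hu : IsIso u) : IsIso (iso_inv hu).
Proof. by exists u; rewrite iso_invK iso_Kinv. Qed.

Lemma composeKV (x y z : C) (u : Hom x y) (hu : IsIso u) (v : Hom x z) :
  v ∘ iso_inv hu ∘ u = v.
Proof. by rewrite -composeA iso_invK composem1. Qed.

Lemma composeVK (x y z : C) (u : Hom x y) (hu : IsIso u) (v : Hom y z) :
  v ∘ u ∘ iso_inv hu = v.
Proof. by rewrite -composeA iso_Kinv composem1. Qed.
End Isomorphisms.

Lemma iso_fmap (C D : Category) (F : Functor C D) (x y : C) (u : Hom x y) :
  IsIso u -> IsIso (fmap F u).
Proof. by move=> [v [vu uv]]; exists (fmap F v); rewrite -!fmapM vu uv !fmap1. Qed.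

Section NaturalIsomorphisms.
Variables (C D : Category) (F G : Functor C D).

Lemma ni_fwd_iso (t : NatIso F G) x : IsIso (t x).
Proof. by exists (ni_inv t x); rewrite ni_fwdK ni_invK. Qed.

Lemma ni_inv_iso (t : NatIso F G) x : IsIso (ni_inv t x).
Proof. by exists (t x); rewrite ni_fwdK ni_invK. Qed.

Section OfIso.
Variables (t : NatTrans F G) (ht : forall x, IsIso (t x)).

Lemma nat_inv_subproof (x y : C) (u : Hom x y) :
  iso_inv (ht y) ∘ fmap G u = fmap F u ∘ iso_inv (ht x).
Proof.
apply: (iso_epi (ht x)); rewrite composeKV -composeA -ntN composeA iso_invK.
exact: compose1m.
Qed.

Definition nat_inv : NatTrans G F :=
  {| ntc := fun x => iso_inv (ht x); ntN := nat_inv_subproof |}.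

Definition natiso_of_iso : NatIso F G :=
  {| ni_fwd := t; ni_inv := nat_inv; ni_fwdK := fun x => iso_invK (ht x);
     ni_invK := fun x => iso_Kinv (ht x) |}.
End OfIso.
End NaturalIsomorphisms.

Section NatComp.
Variables (C D : Category).

Lemma nat_id_subproof (F : Functor C D) (x y : C) (u : Hom x y) :
  idm (F y) ∘ fmap F u = fmap F u ∘ idm (F x).
Proof. by rewrite compose1m composem1. Qed.

Definition nat_id (F : Functor C D) : NatTrans F F :=
  {| ntc := fun x => idm (F x); ntN := @nat_id_subproof F |}.

Definition natiso_id (F : Functor C D) : NatIso F F :=
  natiso_of_iso (t := nat_id F) (fun x => iso_id (F x)).

Lemma nat_comp_subproof (F G H : Functor C D) (b : NatTrans G H)
  (a : NatTrans F G) (x y : C) (u : Hom x y) :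
  b y ∘ a y ∘ fmap F u = fmap H u ∘ (b x ∘ a x).
Proof. by rewrite -composeA ntN composeA ntN composeA. Qed.

Definition nat_comp (F G H : Functor C D) (b : NatTrans G H)
  (a : NatTrans F G) : NatTrans F H :=
  {| ntc := fun x => b x ∘ a x; ntN := nat_comp_subproof b a |}.
End NatComp.

(** * Equivalences as fully faithful and essentially surjective functors *)

Section Equivalences.
Variables (C D : Category) (F : Functor C D).

Definition FullyFaithful : Prop :=
  forall (x y : C) (w : Hom (F x) (F y)), exists! u : Hom x y, fmap F u = w.

Lemma ff_faithful : FullyFaithful ->
  forall (x y : C) (u v : Hom x y), fmap F u = fmap F v -> u = v.
Proof.
by move=> ff x y u v; have [w [_ wU]] := ff x y (fmap F v) => /wU <-; exact: wU.
Qed.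

(** Naturality of [eta] and [eps] makes both [F] and [G] faithful. The preimage of [w] is [fmap G w]
    conjugated by [eta], and faithfulness of [G] lets this be checked after applying [G]. *)
Lemma equivalence_ff : IsEquivalence F -> FullyFaithful.
Proof.
move=> [G [[eta] [eps]]].
have Ff x y (u v : Hom x y) : fmap F u = fmap F v -> u = v.
  move=> e; apply: (iso_epi (ni_fwd_iso eta x)).
  by rewrite -[LHS](ntN eta u) -[RHS](ntN eta v) /= e.
have Gf x y (u v : Hom x y) : fmap G u = fmap G v -> u = v.
  move=> e; apply: (iso_epi (ni_fwd_iso eps x)).
  by rewrite -[LHS](ntN eps u) -[RHS](ntN eps v) /= e.
move=> x y w; exists (eta y ∘ fmap G w ∘ ni_inv eta x); split; last first.
  move=> v <-; apply: (iso_epi (ni_fwd_iso eta x)).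
  rewrite -[RHS](ntN eta v) /= -!composeA.
  by rewrite [X in _ ∘ (_ ∘ X)](ni_fwdK eta x) composem1.
apply: Gf; apply: (iso_mono (ni_fwd_iso eta y)).
rewrite [LHS](ntN eta) /= -!composeA.
by rewrite [X in _ ∘ (_ ∘ X)](ni_fwdK eta x) composem1.
Qed.

Lemma ff_es_equivalence : FullyFaithful ->
  (forall y : D, exists (x : C) (u : Hom (F x) y), IsIso u) -> IsEquivalence F.
Proof.
move=> ff es.
have g (y : D) : {x : C & {u : Hom (F x) y | IsIso u}}.
  by have [x /cid[u hu]] := cid (es y); exists x, u.
pose g0 y := projT1 (g y).
pose eps y : Hom (F (g0 y)) y := sval (projT2 (g y)).
have eI y : IsIso (eps y) := svalP (projT2 (g y)).
have ffx y z (v : Hom y z) : exists u : Hom (g0 y) (g0 z),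
    fmap F u = iso_inv (eI z) ∘ v ∘ eps y.
  by have [u [eu _]] := ff _ _ (iso_inv (eI z) ∘ v ∘ eps y); exists u.
pose g1 y z (v : Hom y z) := projT1 (cid (ffx y z v)).
have g1E y z (v : Hom y z) : eps z ∘ fmap F (g1 y z v) = v ∘ eps y.
  by rewrite /g1; case: cid => u /= ->; rewrite !composeA iso_Kinv compose1m.
have g1U y z (v : Hom y z) u : eps z ∘ fmap F u = v ∘ eps y -> g1 y z v = u.
  by rewrite -g1E => e; apply/(ff_faithful ff)/(iso_mono (eI z)); rewrite e.
have G1 y : g1 y y (idm y) = idm (g0 y).
  by apply: g1U; rewrite fmap1 composem1 compose1m.
have GM x y z (v : Hom y z) (u : Hom x y) : g1 _ _ (v ∘ u) = g1 _ _ v ∘ g1 _ _ u.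
  by apply: g1U; rewrite fmapM composeA g1E -composeA g1E composeA.
pose G := {| fob := g0; fmap := g1; fmap1 := G1; fmapM := GM |}.
exists G; split; last first.
  have eN (x y : D) (u : Hom x y) :
    eps y ∘ fmap (F ∘F G) u = fmap (functor_id D) u ∘ eps x by apply: g1E.
  pose t := @Build_NatTrans D D (F ∘F G) (functor_id D) eps eN.
  by split; exact: (natiso_of_iso (t := t) eI).
have ffe (x : C) : exists u : Hom (g0 (F x)) x, fmap F u = eps (F x).
  by have [u [eu _]] := ff _ _ (eps (F x)); exists u.
pose eta x := projT1 (cid (ffe x)).
have etaE x : fmap F (eta x) = eps (F x) by rewrite /eta; case: cid.
have eN (x y : C) (u : Hom x y) :
    eta y ∘ fmap (G ∘F F) u = fmap (functor_id C) u ∘ eta x.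
  by apply: (ff_faithful ff); rewrite !fmapM !etaE; apply: g1E.
pose t := @Build_NatTrans C C (G ∘F F) (functor_id C) eta eN.
have tI x : IsIso (t x).
  have [v [ev _]] := ff _ _ (iso_inv (eI (F x))).
  exists v; split; apply: (ff_faithful ff); rewrite fmapM fmap1 ev etaE.
    exact: iso_invK.
  exact: iso_Kinv.
by split; exact: (natiso_of_iso tI).
Qed.
End Equivalences.

(** * Equality in Deligne's colimits, and maps out of them *)

Section Fractions.
Variables (C D : Category) (f : Functor C D) (W : MorClass C).

Section Eq.
Hypothesis HW : RightFractions W.
Variables (x : C) (y : D).

Lemma ore_refine (s t : over_ob W x) : exists (r : over_ob W x)
  (a : Hom (ov_src r) (ov_src s)) (b : Hom (ov_src r) (ov_src t)),
  [/\ ov_arr s ∘ a = ov_arr r, ov_arr t ∘ b = ov_arr r & W b].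
Proof.
have [z [b [a [Wb e]]]] := rf_ore HW (ov_arr t) (ov_W s).
by exists (OverOb (rf_comp HW (ov_W t) Wb)), a, b.
Qed.

(** Right fractions collapse a zigzag of colimit steps to a single span, by induction on the
    generated equivalence relation. *)
Lemma del_in_eqP (s t : over_ob W x) (h : Hom (f (ov_src s)) y)
    (k : Hom (f (ov_src t)) y) : del_in h = del_in k ->
  exists (r : over_ob W x) (a : Hom (ov_src r) (ov_src s))
    (b : Hom (ov_src r) (ov_src t)),
  [/\ ov_arr s ∘ a = ov_arr r, ov_arr t ∘ b = ov_arr r &
      h ∘ fmap f a = k ∘ fmap f b].
Proof.
rewrite /del_in /colim_in => /colim_class_inj.
(* The goal is phrased through the dependent pairs so that the induction has variables as
   endpoints. *)
set p := existT _ s h; set q := existT _ t k.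
rewrite -[s]/(projT1 p) -[t]/(projT1 q) -[h]/(projT2 p) -[k]/(projT2 q).
move: p q => p q {s t h k}; elim=> {p q}.
- move=> _ _ [s t [a /= ea] h]; exists t, a, (idm _).
  by split; rewrite ?composem1 //= fmap1 composem1.
- by move=> [s h]; exists s, (idm _), (idm _); rewrite !composem1.
- by move=> p q _ [r [a [b [? ? ?]]]]; exists r, b, a.
- move=> [s h] [t k] [r l] _ /= [r1 [a1 [b1 [e1 e1' E1]]]] _ [r2 [a2 [b2 [e2 e2' E2]]]].
  (* Transitivity: over a common refinement [r3] the two maps to [ov_src t] agree after [ov_arr t],
     and [rf_cancel] equalizes them over a further arrow of [W]. *)
  have [r3 [a [b [ea eb Wb]]]] := ore_refine r1 r2.
  have e : ov_arr t ∘ (b1 ∘ a) = ov_arr t ∘ (a2 ∘ b).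
    by rewrite !composeA e1' e2 ea eb.
  have [v [c [Wc ec]]] := rf_cancel HW (ov_W t) e.
  exists (OverOb (rf_comp HW (ov_W r3) Wc)), (a1 ∘ a ∘ c), (b2 ∘ b ∘ c); split=> /=.
  + by rewrite !composeA e1 ea.
  + by rewrite !composeA e2' eb.
  + by rewrite !fmapM !composeA E1 -E2 -!composeA -!fmapM !composeA ec.
Qed.
End Eq.

(* [alpha] is a morphism of presheaves [Hom_D (f -, y) -> Hom_X (F -, T)]; since
   [F] inverts [W] it extends to Deligne's presheaf. *)
Section Extend.
Variables (X : Category) (F : Functor C X) (FW : Inverts W F) (y : D) (T : X).
Variable alpha : forall x : C, Hom (f x) y -> Hom (F x) T.
Hypothesis alphaN : forall (x x' : C) (a : Hom x' x) (h : Hom (f x) y),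
  alpha (h ∘ fmap f a) = alpha h ∘ fmap F a.

Definition frac (x : C) : colim (phi f W x y) -> Hom (F x) T :=
  colim_rec (F := phi f W x y)
    (fun (s : opc (Lcat W x)) (h : Hom (f (ov_src s)) y) =>
       alpha h ∘ iso_inv (FW (ov_W s))).

Lemma frac_inE (x : C) (s : over_ob W x) (h : Hom (f (ov_src s)) y) :
  frac (del_in h) ∘ fmap F (ov_arr s) = alpha h.
Proof.
rewrite /frac /del_in colim_recE ?composeKV // => i j [a /= ea] k.
apply: (iso_epi (FW (ov_W j))); rewrite composeKV /phi_map /= alphaN.
by rewrite -ea fmapM composeA composeKV.
Qed.

End Extend.
End Fractions.

(** * The category of right fractions *)

Section LocModel.
Variables (C : Category) (W : MorClass C) (HW : RightFractions W).

Lemma ore_square (x z : C) (g : Hom z x) (s : over_ob W x) :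
  exists (r : over_ob W z) (g' : Hom (ov_src r) (ov_src s)),
    ov_arr s ∘ g' = g ∘ ov_arr r.
Proof. by have [[r g'] e] := ore_ex HW g s; exists r, g'. Qed.

Definition over_pre (x : C) (s : over_ob W x) (r : over_ob W (ov_src s))
  : over_ob W x := OverOb (rf_comp HW (ov_W s) (ov_W r)).

Definition loc_hom (x y : C) : Type := colim (phi (functor_id C) W x y).

(* The fraction [u s^-1]. *)
Definition loc_mk (x y : C) (s : over_ob W x) (u : Hom (ov_src s) y)
  : loc_hom x y := @del_in C C (functor_id C) W x y s u.

Lemma loc_mkP (x y : C) (q : loc_hom x y) :
  exists (s : over_ob W x) (u : Hom (ov_src s) y), q = loc_mk u.
Proof. exact: (del_inP q). Qed.

Lemma loc_mkE (x y : C) (s t : over_ob W x) (a : Hom (ov_src t) (ov_src s))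
  (u : Hom (ov_src s) y) (v : Hom (ov_src t) y) :
  ov_arr s ∘ a = ov_arr t -> u ∘ a = v -> loc_mk u = loc_mk v.
Proof. by move=> ea <-;
  exact: esym (@del_inE _ _ (functor_id C) W x y s t a ea u). Qed.

Lemma loc_mk_eqP (x y : C) (s t : over_ob W x) (u : Hom (ov_src s) y)
    (v : Hom (ov_src t) y) : loc_mk u = loc_mk v ->
  exists (r : over_ob W x) (a : Hom (ov_src r) (ov_src s))
    (b : Hom (ov_src r) (ov_src t)),
  [/\ ov_arr s ∘ a = ov_arr r, ov_arr t ∘ b = ov_arr r & u ∘ a = v ∘ b].
Proof. exact: (@del_in_eqP _ _ (functor_id C) W HW x y s t u v). Qed.

Lemma loc_pull_mk (x z y : C) (g : Hom z x) (s : over_ob W x)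
  (u : Hom (ov_src s) y) (t : over_ob W z) (g' : Hom (ov_src t) (ov_src s)) :
  ov_arr s ∘ g' = g ∘ ov_arr t ->
  del_act (f := functor_id C) HW g (idm y) (loc_mk u) = loc_mk (u ∘ g').
Proof.
move=> e; rewrite /loc_mk (del_act_inE (f := functor_id C) HW (idm y) u e).
by rewrite compose1m.
Qed.

Section Push.
Variables (x z : C) (s : over_ob W x).

Definition loc_push : loc_hom (ov_src s) z -> loc_hom x z :=
  colim_rec (F := phi (functor_id C) W (ov_src s) z)
    (fun (r : opc (Lcat W (ov_src s))) (w : Hom (ov_src r) z) =>
       @loc_mk x z (over_pre r) w).

Lemma loc_push_mk (r : over_ob W (ov_src s)) (w : Hom (ov_src r) z) :
  loc_push (loc_mk w) = @loc_mk x z (over_pre r) w.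
Proof.
rewrite /loc_push /loc_mk /del_in colim_recE // => i j [a /= ea] h.
by apply: esym; apply: (@loc_mkE x z (over_pre i) (over_pre j) a) => //=;
  rewrite -composeA ea.
Qed.
End Push.

(** To form [q u s^-1], Deligne's action of [u] pulls [q] back to [ov_src s], and [loc_push] then
    divides by [s]. *)
Definition loc_comp (x y z : C) (q : loc_hom y z) : loc_hom x y -> loc_hom x z :=
  colim_rec (F := phi (functor_id C) W x y)
    (fun (s : opc (Lcat W x)) (u : Hom (ov_src s) y) =>
       @loc_push x z s (del_act (f := functor_id C) HW u (idm z) q)).

(** Any Ore square computes the composite, so each later identity can use a convenient one. *)
Lemma loc_comp_mk (x y z : C) (s : over_ob W x) (u : Hom (ov_src s) y)
  (t : over_ob W y) (v : Hom (ov_src t) z) (r : over_ob W (ov_src s))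
  (u' : Hom (ov_src r) (ov_src t)) : ov_arr t ∘ u' = u ∘ ov_arr r ->
  loc_comp (loc_mk v) (loc_mk u) = @loc_mk x z (over_pre r) (v ∘ u').
Proof.
move=> e; rewrite /loc_comp {2}/loc_mk /del_in colim_recE.
  by rewrite (loc_pull_mk v e) loc_push_mk.
(* Independence of the roof of the right factor: a square for [h ∘ a] is pasted from one for [h] and
   one for [a]. *)
move=> i j [a /= ea] h {r u' e}; rewrite /phi_map /=.
have [r [u' e1]] := ore_square h t.
have [r2 [a' e2]] := ore_square a r.
rewrite (loc_pull_mk v e1) loc_push_mk.
rewrite (loc_pull_mk (g := h ∘ a) v (t := r2) (g' := u' ∘ a')); last first.
  by rewrite -(composeA h a) -e2 !composeA e1.
rewrite loc_push_mk; apply: esym; apply: (@loc_mkE x z (over_pre r) (over_pre r2) a');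
  last by rewrite composeA.
by rewrite /= -composeA e2 composeA ea.
Qed.

Definition over_id1 (x : C) : over_ob W x := OverOb (rf_id HW x).

Definition loc_id (x : C) : loc_hom x x := @loc_mk x x (over_id1 x) (idm x).

Lemma loc_1m (x y : C) (q : loc_hom x y) : loc_comp (loc_id y) q = q.
Proof.
have [s [u ->]] := loc_mkP q.
rewrite (@loc_comp_mk _ _ _ s u (over_id1 y) (idm y) (over_id1 _) u) /=; last first.
  by rewrite compose1m composem1.
by apply: esym;
  apply: (@loc_mkE x y s (over_pre (over_id1 (ov_src s))) (idm (ov_src s))) => //=;
  rewrite ?compose1m ?composem1.
Qed.

Lemma loc_m1 (x y : C) (q : loc_hom x y) : loc_comp q (loc_id x) = q.
Proof.
have [s [u ->]] := loc_mkP q.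
rewrite (@loc_comp_mk _ _ _ (over_id1 x) (idm x) s u s (idm _)) /=; last first.
  by rewrite compose1m composem1.
by apply: esym;
  apply: (@loc_mkE x y s (over_pre (s := over_id1 x) s) (idm (ov_src s))) => //=;
  rewrite ?compose1m ?composem1.
Qed.

(** Three stacked Ore squares give one apex on which both bracketings are computed; the resulting
    denominators differ only by associativity in [C]. *)
Lemma loc_A (x y z w : C) (c : loc_hom z w) (b : loc_hom y z) (a : loc_hom x y) :
  loc_comp c (loc_comp b a) = loc_comp (loc_comp c b) a.
Proof.
have [s [u ->]] := loc_mkP a; have [t [v ->]] := loc_mkP b.
have [r [k ->]] := loc_mkP c.
have [t' [v1 e1]] := ore_square v r.
have [s' [u' e2]] := ore_square u t.
have [s2 [u2 e3]] := ore_square u' t'.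
rewrite (loc_comp_mk k e1) (loc_comp_mk v e2).
rewrite (@loc_comp_mk _ _ _ (over_pre s') (v ∘ u') r k s2 (v1 ∘ u2)); last first.
  by rewrite composeA e1 -composeA e3 composeA.
rewrite (@loc_comp_mk _ _ _ s u (over_pre t') (k ∘ v1) (over_pre s2) u2) /=;
  last first.
  by rewrite -composeA e3 composeA e2 composeA.
by apply: (@loc_mkE x w (over_pre (s := over_pre s') s2) (over_pre (over_pre s2))
  (idm (ov_src s2))) => //=;
  rewrite composem1 ?composeA.
Qed.

Definition Loc : Category :=
  {| Ob := C; Hom := loc_hom; idm := loc_id; compose := loc_comp;
     compose1m := loc_1m; composem1 := loc_m1; composeA := loc_A |}.

Definition loc_map (x y : C) (u : Hom x y) : loc_hom x y :=
  @loc_mk x y (over_id1 x) u.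

Lemma loc_mapM (x y z : C) (v : Hom y z) (u : Hom x y) :
  loc_map (v ∘ u) = loc_comp (loc_map v) (loc_map u).
Proof.
rewrite (@loc_comp_mk _ _ _ (over_id1 x) u (over_id1 y) v (over_id1 x) u) /=.
  by apply: (@loc_mkE x z (over_id1 x) (over_pre (s := over_id1 x) (over_id1 x))
    (idm x)) => //=;
    rewrite ?composem1 ?compose1m.
by rewrite composem1 compose1m.
Qed.

Definition loc_in : Functor C Loc :=
  @Build_Functor C Loc (fun x => x) loc_map (fun x => erefl) loc_mapM.

Lemma loc_mk_in (x y : C) (s : over_ob W x) (u : Hom (ov_src s) y) :
  (loc_mk u : @Hom Loc x y) ∘ fmap loc_in (ov_arr s) = fmap loc_in u.
Proof.
rewrite /= (@loc_comp_mk _ _ _ (over_id1 _) (ov_arr s) s u (over_id1 _) (idm _)) //=.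
by apply: esym;
  apply: (@loc_mkE (ov_src s) y (over_id1 _) (over_pre (s := over_id1 (ov_src s)) (over_id1 _))
    (idm (ov_src s))) => //=;
  rewrite ?composem1 ?compose1m.
Qed.

Lemma loc_in_inverts : Inverts W loc_in.
Proof.
move=> x y s Ws; exists (@loc_mk y x (OverOb Ws) (idm x)); split.
  by rewrite (@loc_mk_in y x (OverOb Ws)).
rewrite /= (@loc_comp_mk _ _ _ (OverOb Ws) (idm x) (over_id1 x) s (over_id1 x)
  (idm x)) //=.
by apply: esym;
  apply: (@loc_mkE y y (over_id1 y) (over_pre (s := OverOb Ws) (over_id1 x)) s) => //=;
  rewrite ?composem1 ?compose1m.
Qed.

Lemma loc_in_eqP (x y : C) (u v : Hom x y) : fmap loc_in u = fmap loc_in v ->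
  exists (x' : C) (s : Hom x' x), W s /\ u ∘ s = v ∘ s.
Proof.
move=> /loc_mk_eqP[r [a [b [/= ea eb e]]]]; move: ea eb.
rewrite !compose1m => ea eb; exists _, (ov_arr r); split; first exact: ov_W.
by rewrite -{1}ea -eb.
Qed.

Section Lift.
Variables (X : Category) (F : Functor C X) (FW : Inverts W F).

Definition loc_lift_map (x y : C) : loc_hom x y -> Hom (F x) (F y) :=
  @frac C C (functor_id C) W X F FW y (F y) (fun x u => fmap F u) x.

Lemma loc_lift_mk (x y : C) (s : over_ob W x) (u : Hom (ov_src s) y) :
  loc_lift_map (loc_mk u) ∘ fmap F (ov_arr s) = fmap F u.
Proof.
apply: (@frac_inE C C (functor_id C) W X F FW y (F y) (fun x u => fmap F u)).
by move=> *; exact: fmapM.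
Qed.

Lemma loc_lift_in (x y : C) (u : Hom x y) : loc_lift_map (loc_map u) = fmap F u.
Proof. by rewrite -[LHS]composem1 -fmap1; apply: (@loc_lift_mk x y (over_id1 x)). Qed.

(** Both sides are compared after composing with the denominator of the composite roof, which [F]
    inverts. *)
Lemma loc_lift_comp (x y z : C) (q : loc_hom y z) (p : loc_hom x y) :
  loc_lift_map (loc_comp q p) = loc_lift_map q ∘ loc_lift_map p.
Proof.
have [s [u ->]] := loc_mkP p; have [t [v ->]] := loc_mkP q.
have [r [u' e]] := ore_square u t; rewrite (loc_comp_mk v e).
apply: (iso_epi (FW (ov_W (over_pre r)))).
rewrite loc_lift_mk /= !fmapM.
have := loc_lift_mk v; have := loc_lift_mk u.
move: (loc_lift_map (loc_mk v)) (loc_lift_map (loc_mk u)) => b a ea eb.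
by rewrite -composeA (composeA a) ea -(fmapM F u) -e fmapM composeA eb.
Qed.

Lemma loc_lift1 (x : C) : loc_lift_map (loc_id x) = idm (F x).
Proof. by rewrite (loc_lift_in (idm x)) fmap1. Qed.

(** Its composite with [loc_in] is [F] strictly: on objects by definition, on arrows by
    [loc_lift_in]. *)
Definition loc_lift : Functor Loc X :=
  @Build_Functor Loc X (fun x => F x) loc_lift_map loc_lift1 loc_lift_comp.
End Lift.
End LocModel.

(** * An arbitrary localization compared with the category of fractions *)

Section Localization.
Variables (C C' : Category) (W : MorClass C) (HW : RightFractions W).
Variables (Q : Functor C C') (HQ : IsLocalization W Q).

Lemma localization_inverts : Inverts W Q. Proof. by have [] := HQ. Qed.

Section Whisker.
Variables (X : Category) (F G : Functor C' X).

Lemma whisker_subproof (a : NatTrans F G) (x y : C) (u : Hom x y) :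
  a (Q y) ∘ fmap (F ∘F Q) u = fmap (G ∘F Q) u ∘ a (Q x).
Proof. exact: (ntN a (fmap Q u)). Qed.

Definition whisker (a : NatTrans F G) : NatTrans (F ∘F Q) (G ∘F Q) :=
  @Build_NatTrans _ _ (F ∘F Q) (G ∘F Q) _ (whisker_subproof a).

Lemma localization_nat_eq (a b : NatTrans F G) :
  (forall x : C, a (Q x) = b (Q x)) -> forall z, a z = b z.
Proof.
have [_ _ ext] := HQ => ab z.
by have [c [_ cU]] := ext _ _ _ (whisker a); rewrite (cU a) // -(cU b).
Qed.
End Whisker.

(** The inverses on the image of [Q] extend to a transformation on [C'], and both composites are
    identities because they are so on the image of [Q]. *)
Lemma localization_nat_iso (X : Category) (F G : Functor C' X)
  (a : NatTrans F G) : (forall x : C, IsIso (a (Q x))) -> forall z, IsIso (a z).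
Proof.
move=> aI z; have [_ _ ext] := HQ.
have [b [bE _]] := ext _ _ _ (nat_inv (t := whisker a) aI).
exists (b z); split.
  apply: (localization_nat_eq (a := nat_comp b a) (b := nat_id F)) => x /=.
  by rewrite bE [LHS]iso_invK.
apply: (localization_nat_eq (a := nat_comp a b) (b := nat_id G)) => x /=.
by rewrite bE [LHS]iso_Kinv.
Qed.

(* [S R = id] only up to isomorphism; its value on the image of [Q] is needed to
   recover a morphism of [C'] from its image under [R]. *)
Lemma localization_compare : exists (R : Functor C' (Loc HW))
  (r : NatIso (R ∘F Q) (loc_in HW))
  (e : NatIso (loc_lift HW localization_inverts ∘F R) (functor_id C')),
  forall x, e (Q x) = loc_lift_map localization_inverts (r x).
Proof.
have [_ lift ext] := HQ.
have [R [r]] := lift _ _ (loc_in_inverts HW); exists R, r.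
set S := loc_lift HW localization_inverts.
(* Since [S] after [loc_in] is strictly [Q], the arrows [fmap S (r x)] form a transformation
   [S R Q -> Q], which extends along [Q] to [S R -> id]. *)
have tN (x y : C) (u : Hom x y) :
    fmap S (r y) ∘ fmap ((S ∘F R) ∘F Q) u = fmap (functor_id C' ∘F Q) u ∘ fmap S (r x).
  rewrite /= -[LHS](fmapM S) -[in RHS](loc_lift_in HW localization_inverts u).
  by rewrite -[RHS](fmapM S); congr (fmap S _); exact: (ntN r u).
have [t [tE _]] := ext _ _ _
  (@Build_NatTrans _ _ ((S ∘F R) ∘F Q) (functor_id C' ∘F Q) _ tN).
have tI := localization_nat_iso (a := t) _.
unshelve eexists (natiso_of_iso (tI _)) => // x; rewrite tE.
exact: (iso_fmap S (ni_fwd_iso r x)).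
Qed.

(** Objects of [Loc] are those of [C], so [R z] itself serves as [x]. *)
Lemma localization_es (z : C') : exists (x : C) (u : Hom (Q x) z), IsIso u.
Proof.
have [R [r [e _]]] := localization_compare.
by exists (R z), (e z); exact: (ni_fwd_iso e z).
Qed.

(** Conjugating [fmap R u] by [r] gives a fraction [v s^-1] in [Loc]; the lift of [Q] and naturality
    of [e] turn it back into [u]. *)
Lemma localization_roof (x y : C) (u : Hom (Q x) (Q y)) :
  exists (x' : C) (s : Hom x' x) (v : Hom x' y), W s /\ u ∘ fmap Q s = fmap Q v.
Proof.
have [R [r [e eE]]] := localization_compare.
have [s [v sv]] := loc_mkP (r y ∘ fmap R u ∘ ni_inv r x).
exists _, (ov_arr s), v; split; first exact: ov_W.
rewrite -(loc_lift_mk localization_inverts v) -sv; congr (_ ∘ _).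
pose S := loc_lift HW localization_inverts.
rewrite -[RHS]/(fmap S (r y ∘ fmap R u ∘ ni_inv r x)) [RHS](fmapM S) (fmapM S).
rewrite -[fmap S (r y)]eE [X in _ = X ∘ _](ntN e u) eE -composeA.
have -> : loc_lift_map localization_inverts (r x) ∘ fmap S (ni_inv r x) = idm _.
  by rewrite -[LHS](fmapM S) -[RHS](fmap1 S); congr (fmap S _); exact: (ni_invK r x).
by rewrite composem1.
Qed.

Lemma localization_eq (x y : C) (u v : Hom x y) : fmap Q u = fmap Q v ->
  exists (x' : C) (s : Hom x' x), W s /\ u ∘ s = v ∘ s.
Proof.
have [R [r _]] := localization_compare => e.
apply: (@loc_in_eqP _ _ HW); apply: (iso_epi (ni_fwd_iso r x)).
by rewrite -[LHS](ntN r u) -[RHS](ntN r v) /= e.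
Qed.
End Localization.

(** * Fibers over [[1]] and universal arrows *)

Lemma arrow_iso_eq (a b : Arrow) : Hom a b -> Hom b a -> a = b.
Proof. by case: a; case: b. Qed.

Lemma arrow_natiso (X : Category) (F G : Functor X Arrow) :
  (forall x, F x = G x) -> NatIso F G.
Proof.
move=> e.
have h x : @Hom Arrow (F x) (G x) by rewrite e; exact: implybb.
have hN (x y : X) (u : Hom x y) : h y ∘ fmap F u = fmap G u ∘ h x.
  exact: arrow_irr.
apply: (natiso_of_iso (t := {| ntc := h; ntN := hN |})) => x.
have h' : @Hom Arrow (G x) (F x) by rewrite e; exact: implybb.
by exists h'; split; exact: arrow_irr.
Qed.

(** The pair of [b] and [u] is initial among arrows from [e] to objects [i b']; equivalently, it
    represents [Hom e (i -)]. *)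
Definition IsUniversal (B E : Category) (i : Functor B E) (e : E) (b : B)
    (u : Hom e (i b)) : Prop :=
  forall (b' : B) (w : Hom e (i b')), exists! k : Hom b b', fmap i k ∘ u = w.

Section Universal.
Variables (B E : Category) (i : Functor B E).

Lemma universal_eq (e : E) (b b' : B) (u : Hom e (i b)) (k k' : Hom b b') :
  IsUniversal u -> fmap i k ∘ u = fmap i k' ∘ u -> k = k'.
Proof.
by move=> uU e1; have [k0 [_ k0U]] := uU _ (fmap i k' ∘ u);
  rewrite -(k0U k) ?(k0U k').
Qed.

Lemma universal_pre (e e' : E) (b : B) (u : Hom e (i b)) (v : Hom e' e) :
  IsUniversal u -> IsIso v -> IsUniversal (u ∘ v).
Proof.
move=> uU vI b' w; have [k [ek kU]] := uU _ (w ∘ iso_inv vI); exists k; split.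
  by rewrite composeA ek composeKV.
by move=> k' ek'; apply: kU; rewrite -ek' composeA composeVK.
Qed.

Lemma universal_iso (e : E) (b b' : B) (u : Hom e (i b)) (u' : Hom e (i b'))
  (k : Hom b b') : IsUniversal u -> IsUniversal u' -> fmap i k ∘ u = u' -> IsIso k.
Proof.
move=> uU u'U ek; have [k' [ek' _]] := u'U _ u; exists k'; split.
  by apply: (universal_eq uU); rewrite fmapM -composeA ek ek' fmap1 compose1m.
by apply: (universal_eq u'U); rewrite fmapM -composeA ek' ek fmap1 compose1m.
Qed.
End Universal.

(** Common ground for Deligne's correspondence and [E']: [A] and [B] are equivalent to the fibers
    over 0 and 1. Objects are reached only up to isomorphism, as befits a localization. *)
Record Fibered (A B E : Category) (p : Functor E Arrow) (i0 : Functor A E)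
    (i1 : Functor B E) : Prop := {
  fb_p0 : forall a, p (i0 a) = false;
  fb_p1 : forall b, p (i1 b) = true;
  fb_ff0 : FullyFaithful i0;
  fb_ff1 : FullyFaithful i1;
  fb_es : forall e : E, (exists (a : A) (u : Hom (i0 a) e), IsIso u) \/
                        (exists (b : B) (u : Hom (i1 b) e), IsIso u) }.

Section FiberedTheory.
Variables (A B E : Category) (p : Functor E Arrow).
Variables (i0 : Functor A E) (i1 : Functor B E) (Hfib : Fibered p i0 i1).

Lemma fibered_iso (x y : E) (u : Hom x y) : IsIso u -> p x = p y.
Proof. by move=> [v _]; apply: arrow_iso_eq; apply: (fmap p). Qed.

Lemma fibered_es0 (x : E) : p x = false ->
  exists (a : A) (u : Hom (i0 a) x), IsIso u.
Proof.
by case: (fb_es Hfib x) => // -[b [u /fibered_iso]]; rewrite (fb_p1 Hfib) => <-.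
Qed.

Lemma fibered_es1 (x : E) : p x = true ->
  exists (b : B) (u : Hom (i1 b) x), IsIso u.
Proof.
by case: (fb_es Hfib x) => // -[b [u /fibered_iso]]; rewrite (fb_p0 Hfib) => <-.
Qed.

Lemma fibered_no_hom (b : B) (a : A) : Hom (i1 b) (i0 a) -> False.
Proof.
by move=> u; have := fmap p u; rewrite /= (fb_p0 Hfib) (fb_p1 Hfib).
Qed.

(** Parallel arrows of [Arrow] are equal, so being cocartesian over 0 -> 1 is a universal property
    among arrows to objects over 1, each isomorphic to some [i1 b]. *)
Lemma fibered_cocartesian : IsCocartesianFibration p <->
  forall a : A, exists (b : B) (u : Hom (i0 a) (i1 b)), IsUniversal u.
Proof.
split=> [cf a | univ x b w].
  have w : @Hom Arrow (p (i0 a)) true by rewrite /= /arrow_hom implybT.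
  have [y [ey [u [uC _]]]] := cf _ _ w.
  have [b [v vI]] := fibered_es1 ey.
  exists b, (iso_inv vI ∘ u) => b' z.
  have h : @Hom Arrow (p y) (p (i1 b')).
    by rewrite /= /arrow_hom (fb_p1 Hfib) implybT.
  have [z' [[_ ez'] z'U]] := uC _ z h (arrow_irr _ _).
  have [k [ek kU]] := fb_ff1 Hfib (z' ∘ v).
  exists k; split; first by rewrite ek composeA composeVK.
  move=> k' ek'; apply: kU; rewrite (z'U (fmap i1 k' ∘ iso_inv vI)) ?composeKV //.
  by split; [exact: arrow_irr | rewrite -composeA].
(* Endomorphisms in [Arrow] lift to identities, which leaves only the lifts of 0 -> 1. *)
have idC (e : p x = b) : exists (y : E) (e : p y = b) (u : Hom x y),
    IsCocartesian p u /\ eq_rect (p y) (Hom (p x)) (fmap p u) b e = w.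
  exists x, e, (idm x); split; last exact: arrow_irr.
  move=> z v ? _; exists v; split;
    first by split; [exact: arrow_irr | exact: composem1].
  by move=> v' [_ <-]; rewrite composem1.
have [px|px] : p x = true \/ p x = false by case: (p x); [left|right].
  by apply: idC; move: w; rewrite px; case: (b).
case: b w idC => w idC; last exact: idC px.
have [a [v vI]] := fibered_es0 px; have [b [u uU]] := univ a.
exists (i1 b), (fb_p1 Hfib b), (u ∘ iso_inv vI); split; last exact: arrow_irr.
have u'U := universal_pre uU (iso_inv_iso vI).
move=> z t h _; have pz : p z = true.
  by move: h; rewrite (fb_p1 Hfib) /= /arrow_hom; case: (p z).
have [b' [z' z'I]] := fibered_es1 pz.
have [k [ek kU]] := u'U _ (iso_inv z'I ∘ t).
exists (z' ∘ fmap i1 k); split.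
  by split; [exact: arrow_irr | rewrite -composeA ek composeA iso_Kinv compose1m].
move=> k' [_ ek'].
have [l [el _]] := fb_ff1 Hfib (iso_inv z'I ∘ k').
rewrite (kU l); first by rewrite el composeA iso_Kinv compose1m.
by rewrite el -composeA ek'.
Qed.

(** The action on arrows is the factorization through the chosen universal arrow; its uniqueness
    gives the functor laws. *)
Lemma universal_functor :
  (forall a : A, exists (b : B) (u : Hom (i0 a) (i1 b)), IsUniversal u) ->
  exists (F : Functor A B) (u : forall a, Hom (i0 a) (i1 (F a))),
    (forall a, IsUniversal (u a)) /\
    forall (a a' : A) (g : Hom a a'), u a' ∘ fmap i0 g = fmap i1 (fmap F g) ∘ u a.
Proof.
move=> univ.
have c a : {b : B & {u : Hom (i0 a) (i1 b) | IsUniversal u}}.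
  by have [b /cid[u uU]] := cid (univ a); exists b, u.
pose F0 a := projT1 (c a); pose u a : Hom (i0 a) (i1 (F0 a)) := sval (projT2 (c a)).
have uU a : IsUniversal (u a) := svalP (projT2 (c a)).
have ex a a' (g : Hom a a') : exists k : Hom (F0 a) (F0 a'),
    u a' ∘ fmap i0 g = fmap i1 k ∘ u a.
  by have [k [<- _]] := uU a _ (u a' ∘ fmap i0 g); exists k.
pose F1 a a' (g : Hom a a') := projT1 (cid (ex a a' g)).
have FN a a' (g : Hom a a') : u a' ∘ fmap i0 g = fmap i1 (F1 a a' g) ∘ u a.
  by rewrite /F1; case: cid.
have F11 a : F1 a a (idm a) = idm (F0 a).
  by apply: (universal_eq (uU a)); rewrite -FN !fmap1 composem1 compose1m.
have F1M a b d (v : Hom b d) (w : Hom a b) : F1 _ _ (v ∘ w) = F1 _ _ v ∘ F1 _ _ w.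
  by apply: (universal_eq (uU a)); rewrite -FN !fmapM composeA FN -!composeA FN.
by exists {| fob := F0; fmap := F1; fmap1 := F11; fmapM := F1M |}, u.
Qed.
End FiberedTheory.

(** * Passing between universal arrows and classifications *)

Section Classify.
Variables (A B E : Category) (p : Functor E Arrow).
Variables (i0 : Functor A E) (i1 : Functor B E) (Hfib : Fibered p i0 i1).
Variables (F : Functor A B) (u : forall a, Hom (i0 a) (i1 (F a))).
Hypothesis uU : forall a, IsUniversal (u a).
Hypothesis uN : forall (a a' : A) (g : Hom a a'),
  u a' ∘ fmap i0 g = fmap i1 (fmap F g) ∘ u a.

Definition cl_ob (c : cyl F) : E :=
  match c with inl a => i0 a | inr b => i1 b end.

Definition cl_map (c d : cyl F) : Hom c d -> Hom (cl_ob c) (cl_ob d) :=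
  match c, d return @Hom (cyl F) c d -> Hom (cl_ob c) (cl_ob d) with
  | inl a, inl a' => fun g => fmap i0 g
  | inl a, inr b => fun h => fmap i1 (h : Hom (F a) b) ∘ u a
  | inr b, inr b' => fun k => fmap i1 k
  | inr _, inl _ => fun e => match e with end
  end.

Lemma cl_map1 (c : cyl F) : cl_map (idm c) = idm (cl_ob c).
Proof. by case: c => c /=; rewrite fmap1. Qed.

Lemma cl_mapM (c d e : cyl F) (v : Hom d e) (w : Hom c d) :
  cl_map (v ∘ w) = cl_map v ∘ cl_map w.
Proof.
case: c d e v w => [c|c] [d|d] [e|e] //= v w; rewrite ?fmapM //.
  by rewrite -!composeA uN /= fmap1 compose1m.
by rewrite /= !fmap1 composem1 composeA.
Qed.

Definition cl_functor : Functor (cyl F) E :=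
  {| fob := cl_ob; fmap := cl_map; fmap1 := cl_map1; fmapM := cl_mapM |}.

(** On arrows from 0 to 1, full faithfulness is exactly the universality of [u a]. *)
Lemma cl_functor_equivalence : IsEquivalence cl_functor.
Proof.
apply: ff_es_equivalence => [[a|b] [a'|b'] w /=|e].
- exact: (fb_ff0 Hfib).
- exact: uU.
- by case: (fibered_no_hom Hfib w).
- exact: (fb_ff1 Hfib).
- case: (fb_es Hfib e) => [[a [v vI]]|[b [v vI]]].
    by exists (inl a), v.
  by exists (inr b), v.
Qed.

Lemma universal_classification : Classification p i0 i1 F.
Proof.
have iso0N (x y : A) (g : Hom x y) :
    idm (i0 y) ∘ fmap (cl_functor ∘F cyl_in0 F) g = fmap i0 g ∘ idm (i0 x).
  exact: nat_id_subproof.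
have iso1N (x y : B) (g : Hom x y) :
    idm (i1 y) ∘ fmap (cl_functor ∘F cyl_in1 F) g = fmap i1 g ∘ idm (i1 x).
  exact: nat_id_subproof.
apply: (@Build_Classification _ _ _ p i0 i1 F cl_functor cl_functor_equivalence).
- apply: arrow_natiso => -[a|b] /=; [exact: (fb_p0 Hfib) | exact: (fb_p1 Hfib)].
- apply: (natiso_of_iso (t := @Build_NatTrans _ _ (cl_functor ∘F cyl_in0 F) i0 _ iso0N)).
  by move=> x; exact: iso_id.
- apply: (natiso_of_iso (t := @Build_NatTrans _ _ (cl_functor ∘F cyl_in1 F) i1 _ iso1N)).
  by move=> x; exact: iso_id.
Qed.
End Classify.

Section ClassificationTheory.
Variables (A B E : Category) (p : Functor E Arrow).
Variables (i0 : Functor A E) (i1 : Functor B E) (F : Functor A B).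
Variable c : Classification p i0 i1 F.

Lemma cyl_arrow_post (a : A) (b : B) (h : Hom (F a) b) :
  cyl_arrow h = fmap (cyl_in1 F) h ∘ cyl_arrow (idm (F a)).
Proof.
by rewrite /cyl_arrow /corr_hom01 /= /corr_ract /= /cyl_map /= fmap1 !composem1.
Qed.

Lemma cyl_arrow_pre (a a' : A) (b : B) (h : Hom (F a) b) (g : Hom a' a) :
  cyl_arrow (h ∘ fmap F g) = cyl_arrow h ∘ fmap (cyl_in0 F) g.
Proof.
by rewrite /cyl_arrow /corr_hom01 /= /corr_lact /= /cyl_map /= compose1m.
Qed.

(** Up to [cl_iso0] and [cl_iso1], composing with [cl_arrow c a] is the action of [cl_fun c] on
    cylinder arrows from 0 to 1, which is bijective since an equivalence is fully faithful. *)
Lemma cl_arrow_universal (a : A) : IsUniversal (cl_arrow c a).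
Proof.
move=> b w; have ff := equivalence_ff (cl_equiv c).
have E1 k : fmap i1 k ∘ cl_arrow c a =
    cl_iso1 c b ∘ fmap (cl_fun c) (cyl_arrow k) ∘ ni_inv (cl_iso0 c) a.
  rewrite /cl_arrow !composeA -(ntN (cl_iso1 c) k).
  by rewrite (cyl_arrow_post k) fmapM /= !composeA.
have [k [ek kU]] := ff (inl a) (inr b) (ni_inv (cl_iso1 c) b ∘ w ∘ cl_iso0 c a).
exists k; split.
  rewrite E1 /cyl_arrow /corr_hom01 ek -!composeA.
  rewrite [X in _ ∘ (_ ∘ (_ ∘ X))](ni_invK (cl_iso0 c) a) composem1.
  by rewrite composeA [X in X ∘ _](ni_invK (cl_iso1 c) b) compose1m.
move=> k' ek'; apply: kU.
have := E1 k'; rewrite ek' => ->; rewrite -!composeA.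
rewrite [X in _ ∘ (_ ∘ (_ ∘ X))](ni_fwdK (cl_iso0 c) a) composem1.
by rewrite composeA [X in X ∘ _](ni_fwdK (cl_iso1 c) b) compose1m.
Qed.

Lemma cl_arrow_natural (a a' : A) (g : Hom a a') :
  cl_arrow c a' ∘ fmap i0 g = fmap i1 (fmap F g) ∘ cl_arrow c a.
Proof.
rewrite /cl_arrow -composeA (ntN (ni_inv (cl_iso0 c)) g) !composeA; congr (_ ∘ _).
rewrite -(ntN (cl_iso1 c) (fmap F g)) -!composeA; congr (_ ∘ _).
by rewrite /= -!fmapM -cyl_arrow_pre compose1m (cyl_arrow_post (fmap F g)).
Qed.
End ClassificationTheory.

(** * Localizing the cylinder *)

Section CylinderFractions.
Variables (C D : Category) (f : Functor C D).
Variables (W : MorClass C) (HW : RightFractions W).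

(* [cyl_class W] does not contain the identities of [D]; adding all isomorphisms
   of [D] gives a class with the same localization which admits a calculus of
   right fractions. *)
Definition cyl_frac : MorClass (cyl f) :=
  fun a b => match a, b return @Hom (cyl f) a b -> Prop with
             | inl x, inl y => fun u => W u
             | inr x, inr y => fun u => IsIso u
             | _, _ => fun _ => False
             end.

Lemma cyl_frac_id (a : cyl f) : cyl_frac (idm a).
Proof. by case: a => a; [exact: (rf_id HW) | exact: iso_id]. Qed.

Lemma cyl_frac_fractions : RightFractions cyl_frac.
Proof.
have isoD (x y : D) (u : Hom x y) : IsIso u -> IsIso (fmap (cyl_in1 f) u).
  exact: iso_fmap.
split.
- exact: cyl_frac_id.
- move=> [x|x] [y|y] [z|z] //= t s; first exact: (rf_comp HW).
  exact: iso_comp.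
- move=> [x|x] [y|y] z // s u.
    case: z u => [z|z] // u Ws.
    have [z' [s' [u' [? ?]]]] := rf_ore HW u Ws.
    by exists (inl z'), s', u'.
  (* Here [s] is an isomorphism of [D], so [s^-1 u] over an identity denominator completes the
     square. *)
  move=> /isoD sI; exists z, (idm z), (iso_inv sI ∘ u).
  by rewrite composem1 composeA iso_Kinv compose1m; split; first exact: cyl_frac_id.
- move=> x [y|y] [z|z] // u v t.
    case: x u v => [x|x] // u v Wt e.
    have [x' [s [? ?]]] := rf_cancel HW Wt e.
    by exists (inl x'), s.
  move=> /isoD tI e; exists x, (idm x); split; first exact: cyl_frac_id.
  by rewrite (iso_mono tI e).
Qed.

(** Every functor preserves the isomorphisms of [D], so the two classes are inverted by the same
    functors. *)
Lemma cyl_frac_localization (E' : Category) (G : Functor (cyl f) E') :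
  IsLocalization (cyl_class (f := f) W) G -> IsLocalization cyl_frac G.
Proof.
move=> [Gi lift ext]; split=> //.
  move=> [x|x] [y|y] // s; first exact: (Gi (inl x) (inl y)).
  by move=> sI; exact: (iso_fmap (G ∘F cyl_in1 f) sI).
move=> X F Fi; apply: lift => -[x|x] [y|y] // s.
exact: (Fi (inl x) (inl y)).
Qed.
End CylinderFractions.

(** * Comparison of Deligne's correspondence with the localized cylinder *)

Section Comparison.
Variables (C D : Category) (f : Functor C D).
Variables (W : MorClass C) (HW : RightFractions W).
Variables (E' : Category) (G : Functor (cyl f) E').
Hypothesis HG : IsLocalization (cyl_class (f := f) W) G.

Let G0 : Functor C E' := G ∘F cyl_in0 f.
Let G1 : Functor D E' := G ∘F cyl_in1 f.
Let HF := cyl_frac_fractions f HW.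
Let HGF := cyl_frac_localization HG.

Lemma loc_cyl_inverts0 : Inverts W G0.
Proof.
by move=> x y s Ws; apply: (localization_inverts HG (x := inl x) (y := inl y)).
Qed.

(** Denominators ending in [D] are isomorphisms of [D], so they can be divided out before
    localizing. *)
Lemma loc_cyl_ff1 : FullyFaithful G1.
Proof.
move=> x y w; have [c [s [v [sF e]]]] := localization_roof HF HGF w.
case: c s v sF e => [c|c] //= s v sI e.
have vE : fmap G1 (v ∘ iso_inv sI) = w.
  apply: (iso_epi (iso_fmap G1 sI)); rewrite -fmapM composeKV.
  exact: esym e.
exists (v ∘ iso_inv sI); split=> // v' e'.
have [d [t [tF et]]] := localization_eq HF HGF (etrans vE (esym e')).
case: d t tF et => [d|d] //= t tI; exact: iso_epi.
Qed.

Lemma loc_cyl_roof0 (x y : C) (w : Hom (G0 x) (G0 y)) :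
  exists (x' : C) (s : Hom x' x) (v : Hom x' y), W s /\ w ∘ fmap G0 s = fmap G0 v.
Proof.
have [c [s [v [sF e]]]] := localization_roof HF HGF w.
by case: c s v sF e => [c|c] // s v Ws e; exists c, s, v.
Qed.

Lemma loc_cyl_eq0 (x y : C) (u v : Hom x y) : fmap G0 u = fmap G0 v ->
  exists (x' : C) (s : Hom x' x), W s /\ u ∘ s = v ∘ s.
Proof.
move=> e; have [c [s [sF es]]] := localization_eq HF HGF e.
by case: c s sF es => [c|c] // s Ws es; exists c, s.
Qed.

(** The canonical functor from Deligne's correspondence to [E'], on arrows from 0 to 1. *)
Definition del_loc (x : C) (y : D) : colim (phi f W x y) -> Hom (G0 x) (G1 y) :=
  frac loc_cyl_inverts0 (fun x (h : Hom (f x) y) => fmap G (cyl_arrow h)) (x := x).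

Lemma del_loc_in (x : C) (y : D) (s : over_ob W x) (h : Hom (f (ov_src s)) y) :
  del_loc (del_in h) ∘ fmap G0 (ov_arr s) = fmap G (cyl_arrow h).
Proof.
apply: frac_inE => x1 x' a k.
by rewrite cyl_arrow_pre fmapM.
Qed.

Lemma del_loc_act (x z : C) (y y' : D) (g : Hom z x) (k : Hom y y')
  (q : colim (phi f W x y)) :
  del_loc (del_act HW g k q) = fmap G1 k ∘ del_loc q ∘ fmap G0 g.
Proof.
have [s [h ->]] := del_inP q; have [t [g' e]] := ore_square HW g s.
rewrite (del_act_inE HW k h e).
apply: (iso_epi (loc_cyl_inverts0 (ov_W t))); rewrite del_loc_in.
rewrite -[RHS]composeA -(fmapM G0 g) -e fmapM [RHS]composeA.
rewrite -(composeA (fmap G1 k)) del_loc_in cyl_arrow_pre fmapM; congr (_ ∘ _).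
rewrite -[RHS](fmapM G (fmap (cyl_in1 f) k)); congr (fmap G _).
by rewrite /cyl_arrow /corr_hom01 /= /corr_ract /= /cyl_map /= fmap1 composem1.
Qed.

Lemma del_loc_inj (x : C) (y : D) : injective (@del_loc x y).
Proof.
move=> q q'; have [s [h ->]] := del_inP q; have [t [k ->]] := del_inP q' => e.
have [r [a [b [ea eb _]]]] := ore_refine HW s t.
rewrite -(del_inE ea) -(del_inE eb).
have /(localization_eq HF HGF) : fmap G (cyl_arrow (h ∘ fmap f a)) =
    fmap G (cyl_arrow (k ∘ fmap f b)).
  have : del_loc (del_in h) ∘ fmap G0 (ov_arr r) =
    del_loc (del_in k) ∘ fmap G0 (ov_arr r) by rewrite e.
  by rewrite -{1}ea -eb !fmapM !composeA !del_loc_in !cyl_arrow_pre !fmapM.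
move=> [[c|c] [v [vF]]] //; rewrite /= /corr_lact /= /cyl_map /= !compose1m => ec.
(* An arrow of [cyl_frac] ending in [C] lies in [W], so [v] refines the common denominator [r] to
   one where the numerators agree. *)
pose r' := OverOb (rf_comp HW (ov_W r) (vF : @W c (ov_src r) v)).
have rE l : del_in (s := r') (l ∘ fmap f (v : @Hom C c (ov_src r))) = del_in (s := r) l.
  by move=> *; exact: del_inE.
by rewrite -rE -[RHS]rE; congr del_in; exact: ec.
Qed.

(** Denominators over an object of [C] come from [W], so a roof from [x] to [y] in the cylinder is
    already a representative in Deligne's colimit. *)
Lemma del_loc_surj (x : C) (y : D) (w : Hom (G0 x) (G1 y)) :
  exists q, del_loc q = w.
Proof.
have [c [s [v [sF e]]]] := localization_roof HF HGF w.
case: c s v sF e => [c|c] // s v Ws e.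
exists (del_in (s := OverOb Ws) v).
by apply: (iso_epi (loc_cyl_inverts0 Ws)); rewrite (del_loc_in (s := OverOb Ws)).
Qed.

Lemma del_fibered : Fibered (del_proj f HW) (del_in0 f HW) (del_in1 f HW).
Proof.
split=> // [x y w|x y w|[x|y]].
- by exists w; split=> // u ->.
- by exists w; split=> // u ->.
- by left; exists x, (idm (inl x : del f HW)); exact: iso_id.
- by right; exists y, (idm (inr y : del f HW)); exact: iso_id.
Qed.

Lemma del_loc_ract (x : C) (y y' : D) (k : Hom y y') (q : colim (phi f W x y)) :
  del_loc (fmap (del_in1 f HW) k ∘ (q : Hom (del_in0 f HW x) (del_in1 f HW y)))
  = fmap G1 k ∘ del_loc q.
Proof. by rewrite [LHS](del_loc_act (idm x) k q) fmap1 composem1. Qed.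

Lemma del_loc_lact (x z : C) (y : D) (g : Hom z x) (q : colim (phi f W x y)) :
  del_loc ((q : Hom (del_in0 f HW x) (del_in1 f HW y)) ∘ fmap (del_in0 f HW) g)
  = del_loc q ∘ fmap G0 g.
Proof. by rewrite [LHS](del_loc_act g (idm y) q) fmap1 compose1m. Qed.

(** [del_loc] is bijective and commutes with postcomposition by arrows of [D]. *)
Lemma del_loc_universal (x : C) (y : D)
  (q : Hom (del_in0 f HW x) (del_in1 f HW y)) :
  IsUniversal q <-> IsUniversal (i := G1) (del_loc q : Hom (G0 x) (G1 y)).
Proof.
split=> qU y' w.
  have [q' eq'] := del_loc_surj w; have [k [ek kU]] := qU _ q'.
  exists k; split; first by rewrite -del_loc_ract ek.
  by move=> k' ek'; apply: kU; apply: del_loc_inj; rewrite del_loc_ract ek'.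
have [k [ek kU]] := qU _ (del_loc w); exists k; split.
  by apply: del_loc_inj; rewrite del_loc_ract.
by move=> k' ek'; apply: kU; rewrite -del_loc_ract ek'.
Qed.

(** * The fibers of [E'], and the comparison of the two derived functors *)

Variables (C' : Category) (Q : Functor C C') (HQ : IsLocalization W Q).
Variables (p' : Functor E' Arrow) (hp' : NatIso (p' ∘F G) (cyl_proj f)).
Variables (j : Functor C' E') (hj : NatIso (j ∘F Q) G0).

(** On the image of [Q], arrows of [C'] and of [E'] are both given by roofs in [C] with denominators
    in [W], matched by [hj]; [localization_es] then reaches all of [C']. *)
Lemma loc_ff0 : FullyFaithful j.
Proof.
have QI := localization_inverts HQ.
have fullQ (x y : C) (w : Hom (j (Q x)) (j (Q y))) :
    exists u : Hom (Q x) (Q y), fmap j u = w.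
  have [x' [s [v [Ws e]]]] := loc_cyl_roof0 (hj y ∘ w ∘ ni_inv hj x).
  exists (fmap Q v ∘ iso_inv (QI _ _ _ Ws)).
  apply: (iso_epi (iso_fmap j (QI _ _ _ Ws))).
  rewrite -fmapM composeKV; apply: (iso_mono (ni_fwd_iso hj y)).
  rewrite [LHS](ntN hj v) -e -!composeA; congr (_ ∘ (_ ∘ _)).
  rewrite composeA [X in X ∘ _](ntN (ni_inv hj) s) -composeA.
  by rewrite [X in _ ∘ X](ni_fwdK hj x') composem1.
(* Over the common denominator [s ∘ t] the numerators agree in [E'], hence in [C] after a further
   arrow of [W]. *)
have faithQ (x y : C) (u v : Hom (Q x) (Q y)) : fmap j u = fmap j v -> u = v.
  move=> e; have [x1 [s [u1 [Ws eu]]]] := localization_roof HW HQ u.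
  have [x2 [t [v1 [Wt ev]]]] := localization_roof HW HQ (v ∘ fmap Q s).
  have Wst := rf_comp HW Ws Wt.
  apply: (iso_epi (QI _ _ _ Wst)).
  have {}eu : u ∘ fmap Q (s ∘ t) = fmap Q (u1 ∘ t) by rewrite !fmapM composeA eu.
  have {}ev : v ∘ fmap Q (s ∘ t) = fmap Q v1 by rewrite fmapM composeA ev.
  have /loc_cyl_eq0[x3 [r [Wr er]]] : fmap G0 (u1 ∘ t) = fmap G0 v1.
    apply: (iso_epi (ni_fwd_iso hj x2)).
    rewrite -[LHS](ntN hj (u1 ∘ t)) -[RHS](ntN hj v1) /= -eu -ev !(fmapM j).
    by rewrite e.
  by rewrite eu ev; apply: (iso_epi (QI _ _ _ Wr)); rewrite -!fmapM er.
have faith (z z' : C') (u v : Hom z z') : fmap j u = fmap j v -> u = v.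
  have [x [a aI]] := localization_es HW HQ z.
  have [y [b bI]] := localization_es HW HQ z'.
  move=> e; apply: (iso_epi aI); apply: (iso_mono (iso_inv_iso bI)).
  by apply: faithQ; rewrite !fmapM e.
move=> z z' w.
have [x [a aI]] := localization_es HW HQ z.
have [y [b bI]] := localization_es HW HQ z'.
have [u eu] := fullQ _ _ (fmap j (iso_inv bI) ∘ w ∘ fmap j a).
exists (b ∘ u ∘ iso_inv aI); split; last first.
  move=> v ev; apply: (iso_epi aI); rewrite composeKV.
  apply: faith; rewrite !fmapM eu -ev !composeA -!fmapM iso_Kinv.
  by rewrite compose1m.
rewrite !fmapM eu !composeA -fmapM iso_Kinv fmap1 compose1m -composeA -fmapM.
by rewrite iso_Kinv fmap1 composem1.
Qed.

Lemma loc_fibered : Fibered p' j G1.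
Proof.
have pG (a : cyl f) : p' (G a) = cyl_proj f a.
  by apply: arrow_iso_eq; [exact: (hp' a) | exact: (ni_inv hp' a)].
split.
- move=> z; have [x [a aI]] := localization_es HW HQ z.
  rewrite -(fibered_iso p' (iso_fmap j aI)) (fibered_iso p' (ni_fwd_iso hj x)).
  exact: (pG (inl x)).
- by move=> y; exact: (pG (inr y)).
- exact: loc_ff0.
- exact: loc_cyl_ff1.
- move=> e; have [[x|y] [u uI]] := localization_es HF HGF e.
    left; exists (Q x), ((u : Hom (G0 x) e) ∘ hj x).
    exact: iso_comp (ni_fwd_iso hj x).
  by right; exists y, u.
Qed.

(** Through [del_loc] and [hj], universal arrows at [x] correspond to universal arrows at [Q x], and
    every object of [C'] is isomorphic to some [Q x]. *)
Lemma del_cocartesian_iff :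
  IsCocartesianFibration (del_proj f HW) <-> IsCocartesianFibration p'.
Proof.
rewrite (fibered_cocartesian del_fibered) (fibered_cocartesian loc_fibered).
split=> univ.
  move=> z; have [x [a aI]] := localization_es HW HQ z.
  have [y [q /del_loc_universal qU]] := univ x.
  exists y, (del_loc q ∘ (hj x ∘ iso_inv (iso_fmap j aI))).
  apply: universal_pre qU _; apply: iso_comp; first exact: ni_fwd_iso.
  exact: iso_inv_iso.
move=> x; have [y [u uU]] := univ (Q x).
have [q eq] := del_loc_surj (u ∘ ni_inv hj x).
exists y, q; apply/del_loc_universal; rewrite eq.
exact: (universal_pre uU (ni_inv_iso hj x)).
Qed.

(** One functor [F], read off [E'], serves both sides: the preimages under [del_loc] of its
    universal arrows show that [F ∘F Q] classifies Deligne's correspondence. *)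
Lemma derived_functors_exist : IsCocartesianFibration p' ->
  inhabited (DeligneDerived f HW Q) /\ inhabited (LocDerived G p' j).
Proof.
move=> /(fibered_cocartesian loc_fibered)/universal_functor[F [u [uU uN]]].
split; last by split; exists F; exact: (universal_classification loc_fibered uU uN).
have q x := cid (del_loc_surj (u (Q x) ∘ ni_inv hj x)).
split; exists F (F ∘F Q); last exact: natiso_id.
pose q1 x : Hom (del_in0 f HW x) (del_in1 f HW ((F ∘F Q) x)) := projT1 (q x).
have qE x : del_loc (q1 x) = u (Q x) ∘ ni_inv hj x by rewrite /q1; case: (q x).
apply: (universal_classification del_fibered (u := q1)).
  move=> x; apply/del_loc_universal; rewrite qE.
  exact: (universal_pre (uU _) (ni_inv_iso hj x)).
move=> x y g; apply: del_loc_inj; rewrite del_loc_lact del_loc_ract.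
by rewrite !qE -composeA [X in _ ∘ X](ntN (ni_inv hj) g) /= composeA uN composeA.
Qed.

Section Canonical.
Variables (L1 : DeligneDerived f HW Q) (L2 : LocDerived G p' j).

Let c1 := cl_arrow (dd_class L1).
Let c2 := cl_arrow (ld_class L2).

(** Writing [del_loc (c1 x)] for the fraction removes the choice of a representative [(s, h)]. *)
Lemma isCanonicalP (th : NatIso L1 L2) : IsCanonical hj th <->
  forall x, fmap G1 (th (Q x) ∘ ni_inv (dd_factor L1) x) ∘ del_loc (c1 x)
            = c2 (Q x) ∘ ni_inv hj x.
Proof.
split=> [can x | can x x' s Ws h e].
  have [[x' s Ws] [h e]] := del_inP (c1 x : colim (phi f W x (dd_base L1 x))).
  have := can x x' s Ws h e => E.
  apply: (iso_epi (loc_cyl_inverts0 Ws)); rewrite -[RHS]E -composeA e.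
  by rewrite (del_loc_in (s := OverOb Ws)).
rewrite -(can x) /c1 e -composeA; congr (_ ∘ _).
exact: esym (del_loc_in (s := OverOb Ws) h).
Qed.

(** Two universal arrows out of [G0 x] differ by a unique isomorphism [t x]; being canonical forces
    this value on the image of [Q]. *)
Lemma canonical_iso_exists : exists th : NatIso L1 L2, IsCanonical hj th /\
  forall th' : NatIso L1 L2, IsCanonical hj th' -> forall z : C', th' z = th z.
Proof.
have U1 x : IsUniversal (i := G1) (del_loc (c1 x)).
  by apply/del_loc_universal; exact: cl_arrow_universal.
have U2 x : IsUniversal (i := G1) (c2 (Q x) ∘ ni_inv hj x).
  apply: universal_pre; last exact: (ni_inv_iso hj x).
  exact: (cl_arrow_universal (ld_class L2)).
have ex x : exists k : Hom (dd_base L1 x) (L2 (Q x)),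
    fmap G1 k ∘ del_loc (c1 x) = c2 (Q x) ∘ ni_inv hj x.
  by have [k [ek _]] := U1 x _ (c2 (Q x) ∘ ni_inv hj x); exists k.
pose t x := projT1 (cid (ex x)).
have tE x : fmap G1 (t x) ∘ del_loc (c1 x) = c2 (Q x) ∘ ni_inv hj x.
  by rewrite /t; case: cid.
have tI x : IsIso (t x) := universal_iso (U1 x) (U2 x) (tE x).
(* Tested against a universal arrow, naturality of [t] reduces to that of [c1], [c2] and [hj]. *)
have tN (x y : C) (g : Hom x y) :
    t y ∘ fmap (dd_base L1) g = fmap (L2 ∘F Q) g ∘ t x.
  apply: (universal_eq (U1 x)); rewrite !fmapM -!composeA tE.
  rewrite -del_loc_ract -[X in del_loc X](cl_arrow_natural (dd_class L1) g).
  rewrite del_loc_lact composeA [X in X ∘ _]tE -composeA.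
  rewrite [X in _ ∘ X](ntN (ni_inv hj) g) [LHS]composeA [RHS]composeA; congr (_ ∘ _).
  exact: (cl_arrow_natural (ld_class L2) (fmap Q g)).
pose tn := @Build_NatTrans _ _ (dd_base L1) (L2 ∘F Q) t tN.
have [_ _ ext] := HQ.
(* Composed with [dd_factor L1], [t] goes between functors factoring through [Q], so it extends
   uniquely to [C']. *)
have [th [thE thU]] := ext _ _ _ (nat_comp tn (dd_factor L1)).
have thI := localization_nat_iso HQ (a := th) _.
unshelve eexists (natiso_of_iso (thI _)).
  by move=> x;
    rewrite thE; apply: iso_comp (tI x) _; exact: (ni_fwd_iso (dd_factor L1) x).
split=> [|th' /isCanonicalP can z].
  apply/isCanonicalP => x; rewrite -[RHS]tE; congr (fmap G1 _ ∘ _).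
  rewrite [X in X ∘ _]thE -[LHS]composeA.
  by rewrite [X in _ ∘ X](ni_invK (dd_factor L1) x) composem1.
apply: thU => x; apply: (iso_epi (ni_inv_iso (dd_factor L1) x)).
rewrite -[RHS]composeA [X in _ = _ ∘ X](ni_invK (dd_factor L1) x) composem1.
by apply: (universal_eq (U1 x)); rewrite tE can.
Qed.
End Canonical.
End Comparison.

Theorem mainTheorem6 : forall
  (C D : Category) (f : Functor C D)
  (W : MorClass C) (HW : RightFractions W)
  (* [C' = C[W^-1]] *)
  (C' : Category) (Q : Functor C C') (HQ : IsLocalization W Q)
  (* [E' = E_f[W^-1]], with the induced functors to [[1]] and from [C'] *)
  (E' : Category) (G : Functor (cyl f) E')
  (HG : IsLocalization (cyl_class (f := f) W) G)
  (p' : Functor E' Arrow) (hp' : NatIso (functor_comp p' G) (cyl_proj f))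
  (j : Functor C' E')
  (hj : NatIso (functor_comp j Q) (functor_comp G (cyl_in0 f))),
  (IsCocartesianFibration (del_proj f HW) <-> IsCocartesianFibration p') /\
  (IsCocartesianFibration p' ->
     inhabited (DeligneDerived f HW Q) /\
     inhabited (LocDerived G p' j) /\
     forall (L1 : DeligneDerived f HW Q) (L2 : LocDerived G p' j),
       exists th : NatIso L1 L2,
         IsCanonical hj th /\
         forall th' : NatIso L1 L2, IsCanonical hj th' ->
           forall z : C', th' z = th z).
Proof.
move=> C D f W HW C' Q HQ E' G HG p' hp' j hj.
split; first exact: (del_cocartesian_iff HW HG HQ hp' hj).
move=> /(derived_functors_exist HW HG HQ hp' hj)[H1 H2].
by split=> //; split=> // L1 L2; exact: (canonical_iso_exists HG HQ hj L1 L2).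
Qed.
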